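(* Let $\Sigma$ be a compact oriented surface with nonempty boundary $\partial\Sigma$, possibly with a finite number of interior points (punctures) removed. Let $p_1\in\partial\Sigma$ be a fixed point and let $p_2\in\Sigma$ be a marked interior point. Then point pushing the marked point $p_2$ determines a bijection between $\pi_1(\Sigma,p_2)$ and the set $\mathcal{A}(p_1,p_2)$ of isotopy classes of arcs in $\Sigma$ connecting $p_1$ and $p_2$. Precisely: for any fixed basepoint $\alpha\in\mathcal{A}(p_1,p_2)$, the map which associates to $\gamma\in\pi_1(\Sigma,p_2)$ the image of $\alpha$ under point pushing of $p_2$ along $\gamma$ is a bijection $\pi_1(\Sigma,p_2)\to\mathcal{A}(p_1,p_2)$.
   Context: An arc is the image of a closed interval under a topological embedding; $\mathcal{A}(p_1,p_2)$ is the set of isotopy classes, with fixed endpoints, of (embedded) arcs in $\Sigma$ with endpoints $p_1$ and $p_2$. Point pushing: the map $\Sigma-\{p_2\}\to\Sigma$ which forgets $p_2$ gives the Birman exact sequence $0\to\pi_1(\Sigma,p_2)\to\mathrm{Mod}(\Sigma-\{p_2\})\to\mathrm{Mod}(\Sigma)\to 0$; the elements of the image of $\pi_1(\Sigma,p_2)$ are called point pushing maps. The point pushing map along a loop $\gamma$ based at $p_2$ is obtained by dragging $p_2$ once along $\gamma$ by an ambient isotopy of $\Sigma$; it can be represented by a diffeomorphism fixing $p_2$ and supported in an arbitrarily small neighborhood of $\gamma$ (in the interior of $\Sigma$, so that it fixes $\partial\Sigma$ and $p_1$), and its class depends only on the homotopy class of $\gamma$. *)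

(* Defs.v *)
From HB Require Import structures.
From mathcomp Require Import all_boot all_order all_algebra.
From mathcomp Require Import all_classical all_reals all_analysis.
From mathcomp Require Import homotopy.
Import Order.TTheory GRing.Theory Num.Theory.
Import numFieldNormedType.Exports.

Set Implicit Arguments.
Unset Strict Implicit.
Unset Printing Implicit Defensive.

Local Open Scope classical_set_scope.
Local Open Scope ring_scope.

(* The closed interval [0, 1] as a space of its own, with endpoints zero and
   one, so that {path I01 R from x to y} is the type of paths in a space. *)
Definition I01 (R : realType) : Type := set_type (`[0%R, 1%R]%classic : set R).

HB.instance Definition _ (R : realType) :=
  Topological.copy (I01 R) (set_type (`[0%R, 1%R]%classic : set R)).

Lemma I01_0_subproof (R : realType) : (0 : R) \in (`[0%R, 1%R]%classic : set R).
Proof. by rewrite inE /= in_itv /= lexx ler01. Qed.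

Lemma I01_1_subproof (R : realType) : (1 : R) \in (`[0%R, 1%R]%classic : set R).
Proof. by rewrite inE /= in_itv /= lexx ler01. Qed.

Definition I01_zero (R : realType) : I01 R := exist _ 0 (I01_0_subproof R).
Definition I01_one (R : realType) : I01 R := exist _ 1 (I01_1_subproof R).

Lemma I01_zero_neq_one (R : realType) : I01_zero R != I01_one R.
Proof. by apply/eqP => -[] /eqP; rewrite eq_sym oner_eq0. Qed.

HB.instance Definition _ (R : realType) :=
  isBiPointed.Build (I01 R) (I01_zero_neq_one R).

Definition homeomorphism (S T : topologicalType) (f : S -> T) : Prop :=
  exists g : T -> S,
    [/\ cancel f g, cancel g f, continuous f & continuous g].

(* The second condition says that the topology of S is induced along f. *)
Definition topological_embedding (S T : topologicalType) (f : S -> T) : Prop :=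
  injective f /\
  forall U : set S, open U <-> exists2 V : set T, open V & f @^-1` V = U.

(* Topological surfaces, possibly with boundary. *)

Definition half_plane (R : realType) : set (R * R) := [set z | 0 <= z.2].
Arguments half_plane : clear implicits.

(* Only the values of cfun on cdom, and those of cinv on cfun @` cdom, are
   meaningful. *)
Record chart (R : realType) (X : topologicalType) := Chart {
  cdom : set X;
  cfun : X -> R * R;
  cinv : R * R -> X }.

(* A homeomorphism from an open set of X onto a relatively open set of the
   closed half plane, with inverse cinv. *)
Definition is_chart (R : realType) (X : topologicalType) (c : chart R X) :=
  [/\ open (cdom c),
      exists2 W : set (R * R), open W & cfun c @` cdom c = W `&` half_plane R,
      {in cdom c, cancel (cfun c) (cinv c)},
      {within cdom c, continuous (cfun c)} &
      {within cfun c @` cdom c, continuous (cinv c)}].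

Definition interior_point (R : realType) (X : topologicalType) : set X :=
  [set x | exists c : chart R X,
     [/\ is_chart c, cdom c x & 0 < (cfun c x).2]].
Arguments interior_point : clear implicits.

Definition boundary (R : realType) (X : topologicalType) : set X :=
  ~` interior_point R X.
Arguments boundary : clear implicits.

(* The closed curve c, parametrized by [0, 1], avoids the origin and has
   winding number 1 around it: rho and 2 pi theta are its polar coordinates. *)
Definition winds_once (R : realType) (c : R -> R * R) : Prop :=
  exists rho theta : R -> R,
    [/\ {within `[0, 1], continuous theta},
        forall t : R, t \in `[0, 1] ->
          0 < rho t /\
          c t = (rho t * cos (2 * pi * theta t), rho t * sin (2 * pi * theta t)) &
        theta 1 = theta 0 + 1].

(* For a map tau that is a homeomorphism from a neighbourhood of z in the plane
   onto an open set: tau has local degree 1 at z. *)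
Definition orientation_preserving_at (R : realType)
    (tau : R * R -> R * R) (z : R * R) : Prop :=
  \forall r \near 0^'+,
    winds_once (fun t : R =>
      tau (z.1 + r * cos (2 * pi * t), z.2 + r * sin (2 * pi * t)) - tau z).

(* Orientations of a surface are orientations of its interior, hence transition
   maps are only tested at points of positive height. *)
Definition oriented_atlas (R : realType) (X : topologicalType)
    (A : set (chart R X)) : Prop :=
  [/\ forall c, A c -> is_chart c,
      forall x : X, exists2 c, A c & cdom c x &
      forall (c d : chart R X) (x : X), A c -> A d -> cdom c x -> cdom d x ->
        0 < (cfun c x).2 ->
        orientation_preserving_at (cfun d \o cinv c) (cfun c x)].

(* A is an orientation of X; X need not be connected. *)
Definition compact_oriented_surface (R : realType) (X : topologicalType)
    (A : set (chart R X)) : Prop :=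
  [/\ hausdorff_space X, compact [set: X] & oriented_atlas A].

(* The surface X with the points of P removed, with the subspace topology. *)
Definition punctured (X : topologicalType) (P : set X) : topologicalType :=
  set_type (~` P).

(* The underlying set of the fundamental group; a class is represented as the
   set of all loops belonging to it. *)

Definition path_homotopic (R : realType) (X : topologicalType) (x y : X)
    (f g : {path (I01 R) from x to y}) : Prop :=
  exists F : I01 R * I01 R -> X,
    [/\ continuous F,
        forall t, F (zero, t) = f t,
        forall t, F (one, t) = g t,
        forall s, F (s, zero) = x &
        forall s, F (s, one) = y].

Definition homotopy_class (R : realType) (X : topologicalType) (x y : X)
    (f : {path (I01 R) from x to y}) : set {path (I01 R) from x to y} :=
  [set g | path_homotopic f g].

Definition pi1 (R : realType) (X : topologicalType) (p : X) :
    set (set {path (I01 R) from p to p}) :=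
  range (@homotopy_class R X p p).
Arguments pi1 R {X} p _.

(* Arcs are subsets, not parametrized curves. *)

Definition arc_param (R : realType) (X : topologicalType) (p q : X)
    (f : I01 R -> X) : Prop :=
  [/\ topological_embedding f, f zero = p & f one = q].

Definition is_arc (R : realType) (X : topologicalType) (p q : X) : set (set X) :=
  [set A | exists2 f : I01 R -> X, arc_param p q f & A = range f].

Definition arc_isotopic (R : realType) (X : topologicalType) (p q : X)
    (A B : set X) : Prop :=
  exists F : I01 R * I01 R -> X,
    [/\ continuous F,
        forall s, arc_param p q (fun t => F (s, t)),
        A = range (fun t => F (zero, t)) &
        B = range (fun t => F (one, t))].

Definition isotopy_class (R : realType) (X : topologicalType) (p q : X)
    (A : set X) : set (set X) :=
  [set B | arc_isotopic R p q A B].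

Definition arc_classes (R : realType) (X : topologicalType) (p q : X) :
    set (set (set X)) :=
  [set isotopy_class R p q A | A in is_arc R p q].

Definition ambient_isotopy (R : realType) (X : topologicalType)
    (H : I01 R * X -> X) : Prop :=
  [/\ continuous H,
      forall t, homeomorphism (fun x => H (t, x)),
      forall x, H (zero, x) = x &
      forall t x, boundary R X x -> H (t, x) = x].

(* h is the end map of an ambient isotopy dragging p along the loop gamma. *)
Definition point_pushing_map (R : realType) (X : topologicalType) (p : X)
    (gamma : {path (I01 R) from p to p}) (h : X -> X) : Prop :=
  exists H : I01 R * X -> X,
    [/\ ambient_isotopy H,
        forall t, H (t, p) = gamma t &
        h = (fun x => H (one, x))].

(* b is an image of the class a under point pushing of q along the class g.
   The loop is chosen in g because a loop that meets the boundary is not the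
   trajectory of q under any ambient isotopy. *)
Definition pushes_to (R : realType) (X : topologicalType) (p q : X)
    (g : set {path (I01 R) from q to q}) (a b : set (set X)) : Prop :=
  exists gamma h A,
    [/\ g gamma, point_pushing_map gamma h, a A &
        b = isotopy_class R p q (h @` A)].

(* Main.v *)
(* If an ambient isotopy drags p2 along a loop u and ends at h, then h(A) is
   homotopic to A . u, because (s, t) |-> H_s(A(t)) is a homotopy between them.
   Hence everything follows from two facts.

   Homotopic arcs from p1 to p2 are isotopic.  Pushing a neighbourhood of p1
   inwards turns an arc into a fixed whisker W at p1 followed by an arc G in the
   interior, and turns a homotopy of arcs into a square G_s(t) in the interior.
   The square lifts through the evaluation map of the homeomorphism group.
   Isotopies need not be ambient, so W . G_s can be shortened from its free end,
   the lift dragging that end back to p2, until only a homeomorphic image of W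
   is left; as s varies these images are isotopic.  No Schoenflies theorem is
   needed.

   Every loop is homotopic to one in the interior, which is the trajectory of p2
   under an ambient isotopy, again by lifting. *)
Require Import Defs.
From HB Require Import structures.
From mathcomp Require Import all_boot all_order all_algebra.
From mathcomp Require Import all_classical all_reals all_analysis.
From mathcomp Require Import homotopy.
From mathcomp Require Import ring lra.
Import Order.TTheory GRing.Theory Num.Theory.
Import numFieldNormedType.Exports.

Local Open Scope classical_set_scope.
Local Open Scope ring_scope.

Set Implicit Arguments.
Unset Strict Implicit.
Unset Printing Implicit Defensive.

(** * Continuity by composition and pasting; finite subcovers *)

Section ContinuityTools.
Context {R : realType}.

(** The intermediate curves of a homotopy between two arcs may cross themselves, so W . G_s is an
    arc only at the two ends s = 0 and s = 1, and only there is it shortened. In between, the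
    homeomorphism [Phi (s, 1) \o Psi (s, 0)] is applied to the whisker alone, whose image is
    embedded whatever G_s looks like. These homeomorphisms fix the boundary pointwise, which keeps
    p1 in place but confines dragging to the interior; hence the separation of a whisker at p1.
    Pushing inwards is injective without being surjective, so it is a different notion from a family
    of homeomorphisms. A lift of a square is assembled from local ones: inside a chart, a shift
    supported in a ball drags the centre to any point of the ball, continuously in that point, and
    the lifts over the cells of a fine grid are glued edge by edge. Bijectivity is then cancellation
    in the fundamental groupoid: composing with the reversed base arc undoes A . u. *)

Lemma continuous_compose (S T U : topologicalType) (f : T -> U) (g : S -> T) :
  continuous f -> continuous g -> continuous (fun x => f (g x)).
Proof. by move=> cf cg x; apply: (@continuous_comp _ _ _ g f); [exact: cg|exact: cf]. Qed.

Lemma continuous_pair (S T U : topologicalType) (f : S -> T) (g : S -> U) :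
  continuous f -> continuous g -> continuous (fun x => (f x, g x)).
Proof. by move=> cf cg x; apply: cvg_pair; [exact: cf|exact: cg]. Qed.

Lemma continuous_compose2 (S T U V : topologicalType) (f : T -> U -> V)
    (g : S -> T) (h : S -> U) :
  continuous (fun p : T * U => f p.1 p.2) -> continuous g -> continuous h ->
  continuous (fun x => f (g x) (h x)).
Proof.
move=> cf cg ch.
by apply: (@continuous_compose _ _ _ (fun p : T * U => f p.1 p.2) (fun x => (g x, h x)));
  [exact: cf | exact: continuous_pair].
Qed.

Lemma continuous_fst (S T : topologicalType) : continuous (@fst S T).
Proof. by move=> x; exact: cvg_fst. Qed.

Lemma continuous_snd (S T : topologicalType) : continuous (@snd S T).
Proof. by move=> x; exact: cvg_snd. Qed.

Lemma continuous_id (S : topologicalType) : continuous (fun x : S => x).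
Proof. by move=> x; exact: cvg_id. Qed.

Lemma continuous_cst (S T : topologicalType) (c : T) : continuous (fun _ : S => c).
Proof. by move=> x; exact: cvg_cst. Qed.

Lemma continuous_add (S : topologicalType) (V : normedModType R) (f g : S -> V) :
  continuous f -> continuous g -> continuous (fun x => f x + g x).
Proof. by move=> cf cg x; apply: cvgD; [exact: cf|exact: cg]. Qed.

Lemma continuous_opp (S : topologicalType) (V : normedModType R) (f : S -> V) :
  continuous f -> continuous (fun x => - f x).
Proof. by move=> cf x; apply: cvgN; exact: cf. Qed.

Lemma continuous_scale (S : topologicalType) (V : normedModType R)
    (a : S -> R) (f : S -> V) :
  continuous a -> continuous f -> continuous (fun x => a x *: f x).
Proof. by move=> ca cf x; apply: cvgZ; [exact: ca|exact: cf]. Qed.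

Lemma continuous_mul (S : topologicalType) (a b : S -> R) :
  continuous a -> continuous b -> continuous (fun x => a x * b x).
Proof. by move=> ca cb x; apply: cvgM; [exact: ca|exact: cb]. Qed.

Lemma continuous_max (S : topologicalType) (a b : S -> R) :
  continuous a -> continuous b -> continuous (fun x => Num.max (a x) (b x)).
Proof. by move=> ca cb x; apply: continuous_max; [exact: ca|exact: cb]. Qed.

Lemma continuous_min (S : topologicalType) (a b : S -> R) :
  continuous a -> continuous b -> continuous (fun x => Num.min (a x) (b x)).
Proof. by move=> ca cb x; apply: continuous_min; [exact: ca|exact: cb]. Qed.

Lemma continuous_normr (S : topologicalType) (V : normedModType R) (f : S -> V) :
  continuous f -> continuous (fun x => `|f x|).
Proof. by move=> cf x; apply: cvg_norm; exact: cf. Qed.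

Lemma continuous_paste (S T : topologicalType) (a : S -> R) (f g : S -> T) :
  continuous a -> continuous f -> continuous g ->
  (forall x, a x = 0 -> f x = g x) ->
  continuous (fun x => if a x <= 0 then f x else g x).
Proof.
move=> ca cf cg fg x U /= Ux.
have [ax|ax|ax] := ltgtP (a x) 0.
- have Uf : nbhs x (f @^-1` U) by apply: cf; rewrite /= (ltW ax) in Ux.
  have Ua : nbhs x [set y | a y < 0].
    by apply: (ca x [set r | r < 0]); exact: open_nbhs_nbhs (conj (@open_lt R 0) ax).
  by apply: filterS2 Uf Ua => y /= Uy /ltW ->.
- have Ug : nbhs x (g @^-1` U) by apply: cg; rewrite leNgt ax /= in Ux.
  have Ua : nbhs x [set y | a y > 0].
    by apply: (ca x [set r | r > 0]); exact: open_nbhs_nbhs (conj (@open_gt R 0) ax).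
  by apply: filterS2 Ug Ua => y /= Uy ay; rewrite leNgt ay.
- have Uf : nbhs x (f @^-1` U) by apply: cf; rewrite ax lexx in Ux.
  have Ug : nbhs x (g @^-1` U) by apply: cg; rewrite -fg //; rewrite ax lexx in Ux.
  by apply: filterS2 Uf Ug => y /= Uf Ug; case: ifP.
Qed.

Lemma continuous_agree_near (S T : topologicalType) (f g : S -> T) (x : S) (O : set S) :
  open O -> O x -> (forall y, O y -> f y = g y) -> {for x, continuous g} ->
  {for x, continuous f}.
Proof.
move=> oO Ox fg cg; rewrite /continuous_at /prop_for (fg _ Ox).
have nO : nbhs x O by exact: open_nbhs_nbhs.
move=> U /cg Ug; rewrite /= nbhs_simpl /=.
by apply: filterS2 nO Ug => y Oy /=; rewrite fg.
Qed.

Lemma compact_finite_subcover (T : topologicalType) (K : set T) (O : T -> set T) :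
  compact K -> (forall x, K x -> open (O x) /\ O x x) ->
  exists s : seq T, (forall x, x \in s -> K x) /\
    forall x, K x -> exists2 y, y \in s & O y x.
Proof.
move=> /compact_near_coveringP cK hO.
(* The filter of finite lists of points of [K], directed by inclusion: the near-covering form of
   compactness turns a list for each point into one list for all of [K]. *)
pose F : set_system (seq T) := [set Q : set (seq T) | exists s0 : seq T,
  (forall x, x \in s0 -> K x) /\
  forall s, {subset s0 <= s} -> (forall x, x \in s -> K x) -> Q s].
have FF : Filter F.
  split.
  - by exists [::]; split.
  - move=> P Q [s [Ks hs]] [t [Kt ht]]; exists (s ++ t); split.
      by move=> x; rewrite mem_cat => /orP[/Ks|/Kt].
    move=> u us Ku; split; [apply: hs|apply: ht] => // x xs; apply: us;
      by rewrite mem_cat xs ?orbT.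
  - by move=> P Q PQ [s [Ks hs]]; exists s; split => // t st Kt; exact/PQ/hs.
have [s0 [Ks0 hs0]] : \near F, K `<=` (fun x => exists2 y, y \in F & O y x).
  apply: cK => x Kx; have [oO Ox] := hO x Kx.
  exists (O x, [set s : seq T | x \in s]) => /=.
    split; first exact: open_nbhs_nbhs.
    exists [:: x]; split; first by move=> y /[1!inE] /eqP ->.
    by move=> s xs _; apply: xs; rewrite inE.
  by move=> [y s] /= [Oy xs]; exists x.
by exists s0; split => //; exact: hs0.
Qed.

End ContinuityTools.

(* ball_shift z r v moves z to z + v and is supported in the ball of radius r
   around z; bump z r is 1/r-Lipschitz, so for |v| < r it is a homeomorphism. *)
Section BallShift.
Context {R : realType} {V : normedModType R}.
Implicit Types (z v x y : V) (r : R).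

Definition bump z r x : R := Num.max 0 (1 - `|x - z| / r).
Definition ball_shift z r v x : V := x + bump z r x *: v.

Lemma bump_ge0 z r x : 0 <= bump z r x.
Proof. by rewrite le_max lexx. Qed.

Lemma bump_le1 z r x : 0 < r -> bump z r x <= 1.
Proof. by move=> r0; rewrite ge_max ler01 lerBlDr lerDl divr_ge0 // ltW. Qed.

Lemma bump_center z r : bump z r z = 1.
Proof. by rewrite /bump subrr normr0 mul0r subr0 max_r. Qed.

Lemma bump_out z r x : 0 < r -> r <= `|x - z| -> bump z r x = 0.
Proof.
by move=> r0 rx; rewrite /bump max_l // subr_le0 ler_pdivlMr // mul1r.
Qed.

Lemma bump_gt0 z r x : 0 < r -> `|x - z| < r -> 0 < bump z r x.
Proof.
by move=> r0 rx; rewrite lt_max subr_gt0 ltr_pdivrMr // mul1r rx orbT.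
Qed.

Lemma bump_lipschitz z r x y : 0 < r ->
  `|bump z r x - bump z r y| <= `|x - y| / r.
Proof.
move=> r0; rewrite /bump.
have h (a b : R) : `|Num.max 0 a - Num.max 0 b| <= `|a - b|.
  case: (leP 0 a) => a0; case: (leP 0 b) => b0 //.
  - by rewrite subr0 !ger0_norm //; lra.
  - by rewrite sub0r normrN (ger0_norm b0) ler0_norm; lra.
  - by rewrite subrr normr0.
apply: le_trans (h _ _) _.
have -> : 1 - `|x - z| / r - (1 - `|y - z| / r) = (`|y - z| - `|x - z|) / r by ring.
rewrite normrM normfV (gtr0_norm r0) ler_pM2r ?invr_gt0 //.
have -> : x - y = (x - z) - (y - z) by rewrite opprB addrA subrK.
by rewrite distrC ler_dist_dist.
Qed.

Lemma continuous_bump z r : 0 < r -> continuous (bump z r).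
Proof.
move=> r0; rewrite /bump; apply: continuous_max; first exact: continuous_cst.
apply: (@continuous_add _ _ R); first exact: continuous_cst.
apply: (@continuous_opp _ _ R); apply: continuous_mul; last exact: continuous_cst.
apply: continuous_normr; apply: continuous_add; first exact: continuous_id.
exact: continuous_cst.
Qed.

Lemma continuous_ball_shift (Z : topologicalType) z r (v : Z -> V) : 0 < r ->
  continuous v -> continuous (fun p : Z * V => ball_shift z r (v p.1) p.2).
Proof.
move=> r0 cv; rewrite /ball_shift; apply: continuous_add; first exact: continuous_snd.
apply: continuous_scale; last by apply: (continuous_compose cv); exact: continuous_fst.
by apply: continuous_compose; [exact: continuous_bump | exact: continuous_snd].
Qed.

Lemma ball_shift_center z r v : ball_shift z r v z = z + v.
Proof. by rewrite /ball_shift bump_center scale1r. Qed.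

Lemma ball_shift_out z r v x : 0 < r -> r <= `|x - z| -> ball_shift z r v x = x.
Proof. by move=> r0 rx; rewrite /ball_shift bump_out // scale0r addr0. Qed.

(** The bump is 1/r-Lipschitz, so the displacements of [x] and [x'] by the same [v] differ by at
    most [|x - x'| * |v| / r]. For [v = v'] the bound gives injectivity; in general it gives joint
    continuity of the inverse in the vector and the point. *)
Lemma ball_shift_expand z r v v' x x' : 0 < r ->
  `|x - x'| * (1 - `|v| / r) <= `|ball_shift z r v x - ball_shift z r v' x'| + `|v - v'|.
Proof.
move=> r0; rewrite /ball_shift.
set b := bump z r x; set b' := bump z r x'.
have -> : x + b *: v - (x' + b' *: v') = (x - x') + (b - b') *: v + b' *: (v - v').
  rewrite scalerBl scalerBr opprD !addrA; congr (_ - _).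
  by rewrite -!addrA addNr addr0; congr (_ + _); rewrite addrC.
have h1 : `|(b - b') *: v| <= `|x - x'| / r * `|v|.
  by rewrite normrZ ler_wpM2r // bump_lipschitz.
have h2 : `|b' *: (v - v')| <= `|v - v'|.
  by rewrite normrZ ger0_norm ?bump_ge0 // ler_piMl // bump_le1.
have h3 : `|x - x'| <= `|x - x' + (b - b') *: v + b' *: (v - v')|
    + `|(b - b') *: v| + `|b' *: (v - v')|.
  set w := (b - b') *: v; set w' := b' *: (v - v').
  have -> : `|x - x'| = `|(x - x' + w + w') - w' - w| by rewrite !addrK.
  apply: le_trans (ler_normB _ _) _; rewrite [leRHS]addrAC lerD2r.
  exact: ler_normB.
have -> : `|x - x'| * (1 - `|v| / r) = `|x - x'| - `|x - x'| / r * `|v| by ring.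
by lra.
Qed.

Lemma ball_shift_inj z r v : `|v| < r -> injective (ball_shift z r v).
Proof.
move=> vr x x' e; have r0 : 0 < r by exact: le_lt_trans vr.
have := ball_shift_expand z v v x x' r0.
rewrite e !subrr !normr0 addr0 pmulr_lle0; last by rewrite subr_gt0 ltr_pdivrMr // mul1r.
by rewrite normr_le0 subr_eq0 => /eqP.
Qed.

(** A preimage of [y] has the form [y - t *: v] with [t] equal to its bump value; the intermediate
    value theorem on [0, 1] finds such a [t]. *)
Lemma ball_shift_surj z r v y : 0 < r -> exists x, ball_shift z r v x = y.
Proof.
move=> r0; pose f (t : R) := bump z r (y - t *: v) - t.
have cf : continuous f.
  apply: (@continuous_add _ _ R); last exact/continuous_opp/continuous_id.
  apply: continuous_compose; first exact: continuous_bump.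
  apply: continuous_add; first exact: continuous_cst.
  apply: continuous_opp; apply: continuous_scale; first exact: continuous_id.
  exact: continuous_cst.
have [t _ /eqP] : exists2 t, t \in `[0, 1] & f t = 0.
  apply: IVT; [exact: ler01 | exact: continuous_subspaceT |].
  rewrite ge_min le_max /f subr0 bump_ge0 /= subr_le0 bump_le1 //.
  by rewrite orbT.
by rewrite subr_eq0 => /eqP e; exists (y - t *: v); rewrite /ball_shift e subrK.
Qed.

Definition ball_unshift z r v y : V := xget y [set x | ball_shift z r v x = y].

Lemma ball_unshiftK z r v : `|v| < r -> cancel (ball_unshift z r v) (ball_shift z r v).
Proof.
move=> vr y; have r0 : 0 < r by exact: le_lt_trans vr.
by rewrite /ball_unshift; case: xgetP => // n; have [x /n] := ball_shift_surj z v y r0.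
Qed.

Lemma ball_shiftK z r v : `|v| < r -> cancel (ball_shift z r v) (ball_unshift z r v).
Proof. by move=> vr x; apply: (ball_shift_inj vr); exact: ball_unshiftK. Qed.

Lemma continuous_ball_unshift (Z : topologicalType) z r (v : Z -> V) :
  continuous v -> (forall t, `|v t| < r) ->
  continuous (fun p : Z * V => ball_unshift z r (v p.1) p.2).
Proof.
move=> cv vr [t y]; apply/cvgrPdist_lt => e e0 /=.
have r0 : 0 < r by exact: le_lt_trans (vr t).
set x := ball_unshift z r (v t) y.
have c0 : 0 < 1 - `|v t| / r by rewrite subr_gt0 ltr_pdivrMr // mul1r.
have d0 : 0 < e * (1 - `|v t| / r) / 2 by rewrite divr_gt0 // mulr_gt0.
have ny : \forall p \near (t, y), `|y - p.2| < e * (1 - `|v t| / r) / 2.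
  have /cvgrPdist_lt/(_ _ d0) : @snd Z V @ (t, y) --> y by exact: cvg_snd.
  by [].
have nv : \forall p \near (t, y), `|v t - v p.1| < e * (1 - `|v t| / r) / 2.
  have : continuous (fun p : Z * V => v p.1).
    by apply: (continuous_compose cv); exact: continuous_fst.
  by move=> /(_ (t, y)) /cvgrPdist_lt/(_ _ d0).
apply: filterS2 ny nv => p /= hy hv; set x' := ball_unshift z r (v p.1) p.2.
have := ball_shift_expand z (v t) (v p.1) x x' r0.
rewrite !ball_unshiftK // => h.
by rewrite -(ltr_pM2r c0); apply: le_lt_trans h _; lra.
Qed.

(** An image outside the ball would be a fixed point, and injectivity would then identify it with
    [x], which is inside. *)
Lemma ball_shift_ball z r v x : `|v| < r ->
  `|x - z| < r -> `|ball_shift z r v x - z| < r.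
Proof.
move=> vr xr; have r0 : 0 < r by exact: le_lt_trans vr.
rewrite ltNge; apply/negP => h.
have /(ball_shift_inj vr) e := ball_shift_out v r0 h.
by move: h; rewrite e leNgt xr.
Qed.

Lemma ball_unshift_out z r v x : `|v| < r -> r <= `|x - z| -> ball_unshift z r v x = x.
Proof.
move=> vr xr; have r0 : 0 < r by exact: le_lt_trans vr.
by rewrite -{1}(ball_shift_out v r0 xr) ball_shiftK.
Qed.

Lemma ball_unshift_ball z r v x : `|v| < r ->
  `|x - z| < r -> `|ball_unshift z r v x - z| < r.
Proof.
move=> vr xr; have r0 : 0 < r by exact: le_lt_trans vr.
rewrite ltNge; apply/negP => h.
have := ball_shift_out v r0 h; rewrite ball_unshiftK // => e.
by move: h; rewrite -e leNgt xr.
Qed.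

End BallShift.

(** * Transporting half-plane maps through charts *)

Section Charts.
Context {R : realType} {Y : topologicalType}.
Implicit Types (c : chart R Y) (x y : Y) (p q z : R * R) (r : R).

Lemma within_continuous_near (S T : topologicalType) (A : set S) (f : S -> T) (x : S) (N : set T) :
  {within A, continuous f} -> A x -> nbhs (f x) N -> \forall y \near x, (A y -> N (f y)).
Proof.
move=> cf Ax Nfx; have := cf x N Nfx.
by rewrite nbhs_simpl /= {1}/nbhs /= -nbhs_subspace_in.
Qed.

Lemma cfun_near c x (N : set (R * R)) : is_chart c -> cdom c x ->
  nbhs (cfun c x) N -> \forall y \near x, (cdom c y /\ N (cfun c y)).
Proof.
move=> [oc _ _ cc _] cx Nx.
have := within_continuous_near cc cx Nx.
have : nbhs x (cdom c) by exact: open_nbhs_nbhs.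
by apply: filterS2 => y cy /(_ cy).
Qed.

Lemma cinvK c x : is_chart c -> cdom c x -> cinv c (cfun c x) = x.
Proof. by move=> [_ _ h _ _] cx; apply: h; rewrite inE. Qed.

Lemma cinv_dom c p : is_chart c -> (cfun c @` cdom c) p ->
  cdom c (cinv c p) /\ cfun c (cinv c p) = p.
Proof. by move=> hc [x cx <-]; rewrite cinvK. Qed.

Lemma cfun_ge0 c x : is_chart c -> cdom c x -> 0 <= (cfun c x).2.
Proof.
move=> [_ [W _ e] _ _ _] cx.
by have [] : (W `&` half_plane R) (cfun c x) by rewrite -e; exists x.
Qed.

Lemma open_interior_point : open (interior_point R Y).
Proof.
rewrite openE => x [c [hc cx hx]].
have := @cfun_near c x [set p | 0 < p.2] hc cx.
have h2 : nbhs (cfun c x) [set p : R * R | 0 < p.2].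
  apply: (@continuous_snd _ _ (cfun c x) [set t : R | 0 < t]).
  exact: open_nbhs_nbhs (conj (@open_gt R 0) hx).
by move=> /(_ h2); apply: filterS => y [cy hy]; exists c.
Qed.

Definition closed_half_ball z r : set (R * R) := [set p | `|p - z| <= r /\ 0 <= p.2].

Lemma compact_closed_half_ball z r : compact (closed_half_ball z r).
Proof.
(* The norm of the plane is the maximum norm, so a half ball is a rectangle. *)
have -> : closed_half_ball z r =
    `[z.1 - r, z.1 + r] `*` `[Num.max 0 (z.2 - r), z.2 + r].
  apply/seteqP; split => -[a b] /=;
    rewrite /closed_half_ball /= !in_itv /= prod_normE /= !ge_max !ler_norml.
    by move=> [] /andP[] /andP[? ?] /andP[? ?] ?; split; lra.
  by move=> [] /andP[? ?] /andP[] /andP[? ?] ?; split; lra.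
by apply: compact_setX; exact: segment_compact.
Qed.

Lemma chart_ball c x (U : set Y) : is_chart c -> cdom c x -> open U -> U x ->
  exists r, [/\ 0 < r, closed_half_ball (cfun c x) r `<=` cfun c @` cdom c,
    forall p, closed_half_ball (cfun c x) r p -> U (cinv c p) &
    0 < (cfun c x).2 -> r < (cfun c x).2].
Proof.
move=> hc cx oU Ux; have [oc [W oW e] _ cc ci] := hc.
set z := cfun c x.
have Az : (cfun c @` cdom c) z by exists x.
have [Wz hz] : (W `&` half_plane R) z by rewrite -e.
have nU : nbhs (cinv c z) U by apply: open_nbhs_nbhs; split=> //; rewrite cinvK.
have n1 := within_continuous_near ci Az nU.
have n2 : nbhs z W by exact: open_nbhs_nbhs.
have [d d0 hd] : exists2 d, 0 < d & forall p, `|p - z| < d ->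
    W p /\ ((cfun c @` cdom c) p -> U (cinv c p)).
  have [d d0 hd] := (nbhs_normP z _).1 (filterI n2 n1).
  by exists d => // p pd; apply: hd; rewrite /= distrC.
(* Halving [d] puts the closed ball inside the open one of radius [d]; at an interior point, halving
   the height keeps the ball off the boundary line. *)
pose r := if 0 < z.2 then Num.min (d / 2) (z.2 / 2) else d / 2.
have r0 : 0 < r by rewrite /r; case: ifP => hz0; rewrite ?lt_min ?divr_gt0.
have rd : r < d.
  by rewrite /r; case: ifP => _; rewrite ?gt_min; [apply/orP; left|]; lra.
have hr p : closed_half_ball z r p -> W p /\ ((cfun c @` cdom c) p -> U (cinv c p)).
  by move=> [pz _]; apply: hd; exact: le_lt_trans rd.
exists r; split => //.
- by move=> p pz; rewrite e; split; [exact: (hr _ pz).1 | exact: pz.2].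
- by move=> p pz; apply: (hr _ pz).2; rewrite e; split; [exact: (hr _ pz).1 | exact: pz.2].
- by rewrite /r => h; rewrite h gt_min; apply/orP; right; lra.
Qed.

(** The conditions under which a map of the half plane, read in a chart whose image contains the
    closed half ball, extends by the identity. *)
Definition half_ball_map z r (tau : R * R -> R * R) :=
  (forall p, r <= `|p - z| -> tau p = p) /\
  (forall p, `|p - z| < r -> 0 <= p.2 -> `|tau p - z| < r /\ 0 <= (tau p).2).

Definition chart_extend c (tau : R * R -> R * R) x : Y :=
  if x \in cdom c then cinv c (tau (cfun c x)) else x.

Section ChartExtend.
Variables (c : chart R Y) (z : R * R) (r : R).
Hypotheses (hc : is_chart c) (hz : closed_half_ball z r `<=` cfun c @` cdom c).

Lemma half_ball_map_image tau x : half_ball_map z r tau -> cdom c x ->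
  (cfun c @` cdom c) (tau (cfun c x)).
Proof.
move=> [h1 h2] cx; have [/h1 -> | lt] := leP r `|cfun c x - z|; first by exists x.
have [h3 h4] := h2 _ lt (cfun_ge0 hc cx).
by apply: hz; split => //; exact: ltW.
Qed.

Lemma chart_extend_out tau x : ~ cdom c x -> chart_extend c tau x = x.
Proof. by move=> cx; rewrite /chart_extend memNset. Qed.

Lemma chart_extend_in tau x : half_ball_map z r tau -> cdom c x ->
  cdom c (chart_extend c tau x) /\ cfun c (chart_extend c tau x) = tau (cfun c x).
Proof.
by move=> ht cx; rewrite /chart_extend mem_set //; apply: cinv_dom => //; exact: half_ball_map_image.
Qed.

Lemma chart_extend_fix tau x : cdom c x -> tau (cfun c x) = cfun c x ->
  chart_extend c tau x = x.
Proof. by move=> cx e; rewrite /chart_extend mem_set // e cinvK. Qed.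

Lemma chart_extendK tau sig : half_ball_map z r tau ->
  (forall x, cdom c x -> sig (tau (cfun c x)) = cfun c x) ->
  cancel (chart_extend c tau) (chart_extend c sig).
Proof.
move=> ht hk x; have [cx|cx] := pselect (cdom c x); last by rewrite !chart_extend_out.
have [c1 e1] := chart_extend_in ht cx.
by rewrite {1}/chart_extend mem_set // e1 hk // cinvK.
Qed.

(** The extension preserves both the chart domain and its complement, so points of the two cannot
    collide. No inverse of [tau] is assumed, since inward pushes are not onto the half plane. *)
Lemma chart_extend_inj tau : half_ball_map z r tau ->
  injective tau -> injective (chart_extend c tau).
Proof.
move=> ht it x y e.
have h u : cdom c (chart_extend c tau u) -> cdom c u.
  by move=> cu; apply: contrapT => n; move: cu; rewrite chart_extend_out.
have [cx|cx] := pselect (cdom c x); last first.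
  have [cy|cy] := pselect (cdom c y); last by rewrite !chart_extend_out in e.
  by exfalso; apply/cx/h; rewrite e; exact: (chart_extend_in ht cy).1.
have cy : cdom c y by apply: h; rewrite -e; exact: (chart_extend_in ht cx).1.
have := congr1 (cfun c) e; rewrite !(chart_extend_in ht _).2 // => /it /(congr1 (cinv c)).
by rewrite !cinvK.
Qed.

(** The closed half ball is compact, so its image in the Hausdorff space [Y] is closed; off that
    image the extension is the identity, which settles the points outside the chart. *)
Lemma continuous_chart_extend (Z : topologicalType) (tau : Z -> R * R -> R * R) :
  hausdorff_space Y -> (forall t, half_ball_map z r (tau t)) ->
  continuous (fun p : Z * (R * R) => tau p.1 p.2) ->
  continuous (fun p : Z * Y => chart_extend c (tau p.1) p.2).
Proof.
move=> hY ht ct [t x]; have [oc [W oW e] _ cc ci] := hc.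
pose C : set Y := cinv c @` closed_half_ball z r.
have CC : closed C.
  apply: compact_closed => //; apply: continuous_compact; last exact: compact_closed_half_ball.
  exact: continuous_subspaceW ci.
have Cdom y : C y -> cdom c y by move=> [p /hz /(cinv_dom hc)[+ _] <-].
have [cx|cx] := pselect (cdom c x); last first.
  apply: (@continuous_agree_near _ _ _ snd (t, x) (snd @^-1` ~` C)).
  - by apply: open_comp; [move=> *; exact: continuous_snd | exact: closed_openC].
  - by move=> /Cdom.
  - move=> [s y] /= Cy; have [cy|cy] := pselect (cdom c y); last exact: chart_extend_out.
    apply: chart_extend_fix => //; apply: (ht s).1; rewrite leNgt; apply/negP => lt.
    apply: Cy; exists (cfun c y); last exact: cinvK.
    by split; [exact: ltW | exact: cfun_ge0].
  - exact: continuous_snd.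
move=> N; rewrite /= {1}/chart_extend mem_set // => Np.
have n1 := within_continuous_near ci (half_ball_map_image (ht t) cx) Np.
have [[A B] [/= nA nB] AB] := ct (t, cfun c x) _ n1.
exists (A, [set y | cdom c y /\ B (cfun c y)]) => /=.
  by split => //; exact: cfun_near.
move=> [s y] [/= As [cy By]]; rewrite /chart_extend mem_set //.
by apply: (AB (s, cfun c y)) => //; exact: half_ball_map_image.
Qed.

End ChartExtend.
End Charts.

(** * Continuous families of homeomorphisms and pushing into the interior *)

Section HomeoFamilies.
Context {R : realType} {Y : topologicalType}.
Hypothesis hY : hausdorff_space Y.
Implicit Types (c : chart R Y) (x y : Y).
Let int : set Y := interior_point R Y.

(** A continuous map from [Z] to the homeomorphism group relative to the boundary, without a
    topology on that group. With jointly continuous inverses as part of the data, families can be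
    inverted and composed. *)
Definition homeo_family (Z : topologicalType) (Phi Psi : Z -> Y -> Y) :=
  [/\ continuous (fun p : Z * Y => Phi p.1 p.2),
      continuous (fun p : Z * Y => Psi p.1 p.2),
      forall t, cancel (Phi t) (Psi t),
      forall t, cancel (Psi t) (Phi t) &
      forall t x, boundary R Y x -> Phi t x = x].

Lemma homeo_family_inv (Z : topologicalType) (Phi Psi : Z -> Y -> Y) :
  homeo_family Phi Psi -> homeo_family Psi Phi.
Proof.
by move=> [c1 c2 k1 k2 b]; split => // t x bx; rewrite -{1}(b t x bx) k1.
Qed.

Lemma homeo_family_comp (Z : topologicalType) (Phi Psi Phi' Psi' : Z -> Y -> Y) :
  homeo_family Phi Psi -> homeo_family Phi' Psi' ->
  homeo_family (fun t x => Phi t (Phi' t x)) (fun t x => Psi' t (Psi t x)).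
Proof.
move=> [c1 c2 k1 k2 b] [c1' c2' k1' k2' b']; split.
- apply: (continuous_compose2 c1); [exact: continuous_fst | exact: c1'].
- apply: (continuous_compose2 c2'); [exact: continuous_fst | exact: c2].
- by move=> t x; rewrite k1 k1'.
- by move=> t x; rewrite k2' k2.
- by move=> t x bx; rewrite b' // b.
Qed.

Lemma homeo_family_pull (Z Z' : topologicalType) (g : Z' -> Z) (Phi Psi : Z -> Y -> Y) :
  continuous g -> homeo_family Phi Psi ->
  homeo_family (fun t => Phi (g t)) (fun t => Psi (g t)).
Proof.
move=> cg [c1 c2 k1 k2 b]; split => //.
- apply: (continuous_compose2 c1); last exact: continuous_snd.
  by apply: (continuous_compose cg); exact: continuous_fst.
- apply: (continuous_compose2 c2); last exact: continuous_snd.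
  by apply: (continuous_compose cg); exact: continuous_fst.
- by move=> t; exact: b.
Qed.

Lemma chart_ball_open c (z : R * R) r : is_chart c ->
  open [set x | cdom c x /\ `|cfun c x - z| < r].
Proof.
move=> hc; rewrite openE => x [cx xr].
apply: (@cfun_near _ _ c x [set p | `|p - z| < r]) => //.
have cn : continuous (fun p : R * R => `|p - z|).
  apply: continuous_normr; apply: continuous_add; first exact: continuous_id.
  exact: continuous_cst.
apply: (cn (cfun c x) [set t | t < r]).
exact: open_nbhs_nbhs (conj (@open_lt R r) xr).
Qed.

Lemma snd_le_norm (p : R * R) : `|p.2| <= `|p|.
Proof. by rewrite prod_normE le_max lexx orbT. Qed.

(** A local section over [D] of the evaluation of homeomorphisms at [y], in the form of its
    pullbacks along all maps into [D]. *)
Definition draggable (D : set Y) y :=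
  forall (Z : topologicalType) (F : Z -> Y), continuous F -> (forall t, D (F t)) ->
    exists Phi Psi : Z -> Y -> Y, homeo_family Phi Psi /\ forall t, Phi t y = F t.

(** In a chart, a ball shift carries the centre [z] to the coordinates of [F t]. The radius is less
    than the height of [z], so the support misses the boundary. *)
Lemma interior_draggable y : int y -> exists2 D, open D /\ D y & draggable D y.
Proof.
move=> [c [hc cy hy]]; set z := cfun c y in hy.
have [r [r0 hz _ /(_ hy) rz]] := chart_ball hc cy openT I.
exists [set x | cdom c x /\ `|cfun c x - z| < r].
  by split; [exact: chart_ball_open | split => //; rewrite subrr normr0].
move=> Z F cF DF; pose v t := cfun c (F t) - z.
have vr t : `|v t| < r by have [] := DF t.
have cv : continuous v.
  apply: continuous_add; last exact: continuous_cst.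
  move=> t N /(cfun_near hc (DF t).1) n.
  have n2 : nbhs t (F @^-1` [set y | cdom c y /\ N (cfun c y)]) by exact: cF.
  by apply: filterS n2 => s [].
have hp (p : R * R) : `|p - z| < r -> 0 <= p.2.
  move=> h; have := le_lt_trans (snd_le_norm _) h.
  by rewrite /= ltr_norml => /andP[? _]; lra.
have h1 t : half_ball_map z r (ball_shift z r (v t)).
  split=> p hpr; first exact: ball_shift_out.
  by move=> _; have h := ball_shift_ball (vr t) hpr; split => //; exact: hp.
have h2 t : half_ball_map z r (ball_unshift z r (v t)).
  split=> p hpr; first exact: ball_unshift_out.
  by move=> _; have h := ball_unshift_ball (vr t) hpr; split => //; exact: hp.
exists (fun t => chart_extend c (ball_shift z r (v t))).
exists (fun t => chart_extend c (ball_unshift z r (v t))); split.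
  split.
  - apply: (continuous_chart_extend hc hz hY h1).
    exact: continuous_ball_shift.
  - apply: (continuous_chart_extend hc hz hY h2).
    exact: continuous_ball_unshift.
  - by move=> t; apply: (chart_extendK hc hz (h1 t)) => x _; rewrite ball_shiftK.
  - by move=> t; apply: (chart_extendK hc hz (h2 t)) => x _; rewrite ball_unshiftK.
  - move=> t x bx; have [cx|cx] := pselect (cdom c x); last exact: chart_extend_out.
    apply: (chart_extend_fix hc) => //; apply: ball_shift_out => //.
    rewrite leNgt; apply/negP => h; apply: bx; exists c; split => //.
    have := le_lt_trans (snd_le_norm _) h.
    by rewrite /= ltr_norml => /andP[? _]; lra.
by move=> t; rewrite /chart_extend mem_set // ball_shift_center addrC subrK cinvK //; have [] := DF t.
Qed.

(* By the last clause, a composite of such isotopies pushes into the interior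
   every point that one of its factors pushes there. *)
Definition inward_isotopy (N : R -> Y -> Y) :=
  [/\ continuous (fun p : R * Y => N p.1 p.2),
      forall s, injective (N s),
      forall x, N 0 x = x &
      forall s x, N s x = x \/ int (N s x)].

Lemma inward_isotopy_interior N s x : inward_isotopy N -> int x -> int (N s x).
Proof. by move=> [_ _ _ /(_ s x) []// ->]. Qed.

Lemma inward_isotopy_id : inward_isotopy (fun _ x => x).
Proof. by split=> [|s x y|x|s x]; [exact: (@continuous_snd R Y) | by [] | by [] | left]. Qed.

Lemma inward_isotopy_comp N N' : inward_isotopy N -> inward_isotopy N' ->
  inward_isotopy (fun s x => N s (N' s x)).
Proof.
move=> hN hN'; have [c1 i1 z1 o1] := hN; have [c2 i2 z2 o2] := hN'; split.
- apply: (continuous_compose2 c1); [exact: continuous_fst | exact: c2].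
- by move=> s x y /i1 /i2.
- by move=> x; rewrite z2 z1.
- move=> s x; case: (o2 s x) => [->|h]; first exact: o1.
  by right; exact: inward_isotopy_interior.
Qed.

(** The push is a vertical shift in a chart centred at [y]. The last clause says that at time [s]
    the whole surface has left the part of the track of [y] belonging to times before [s]; this
    leaves room for the whisker, and it also makes the track injective. *)
Lemma boundary_push y (U : set Y) c : is_chart c -> cdom c y -> ~ int y ->
  open U -> U y ->
  exists (O : set Y) (N : R -> Y -> Y),
    [/\ open O /\ O y,
        inward_isotopy N,
        forall s x, ~ U x -> N s x = x,
        forall s x, 0 < s -> O x -> int (N s x) &
        forall s s' x, 0 <= s <= 1 -> 0 <= s' <= 1 -> N s x = N s' y -> s <= s'].
Proof.
move=> hc cy iy oU Uy; set z := cfun c y.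
have hy : z.2 = 0.
  apply/eqP; rewrite eq_le (cfun_ge0 hc cy) andbT leNgt; apply/negP => h.
  by apply: iy; exists c.
have [r [r0 hz hU _]] := chart_ball hc cy oU Uy.
(* Clamping the time, together with the factor [r / 2] below, keeps the shift vector shorter than
   [r] for every real [s]. *)
pose cl (s : R) : R := Num.max 0 (Num.min 1 s).
have cl01 s : 0 <= cl s <= 1 by rewrite /cl le_max lexx /= ge_max ler01 ge_min lexx.
have clid s : 0 <= s <= 1 -> cl s = s.
  by move=> /andP[s0 s1]; rewrite /cl min_r // max_r.
pose v s : R * R := (0, cl s * (r / 2)).
have vr s : `|v s| < r.
  have := cl01 s; rewrite prod_normE /= normr0 gt_max r0 /= => /andP[h1 h2].
  by rewrite ger0_norm; nra.
have sh2 s p : (ball_shift z r (v s) p).2 = p.2 + bump z r p * (cl s * (r / 2)) by [].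
have sh1 s (p : R * R) : (ball_shift z r (v s) p).1 = p.1.
  by rewrite -[RHS]addr0 -[X in _ = _ + X](mulr0 (bump z r p)).
have lift0 s p : 0 <= bump z r p * (cl s * (r / 2)).
  have /andP[c0 _] := cl01 s.
  by rewrite mulr_ge0 ?bump_ge0 // mulr_ge0 // divr_ge0 // ltW.
have h1 s : half_ball_map z r (ball_shift z r (v s)).
  split=> p hpr; first exact: ball_shift_out.
  move=> hp; split; first exact: ball_shift_ball.
  by rewrite sh2 addr_ge0.
exists [set x | cdom c x /\ `|cfun c x - z| < r].
exists (fun s => chart_extend c (ball_shift z r (v s))); split.
- by split; [exact: chart_ball_open | split => //; rewrite subrr normr0].
- split.
  + apply: (continuous_chart_extend hc hz hY h1).
    apply: continuous_ball_shift => //.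
    apply: continuous_pair; first exact: continuous_cst.
    apply: continuous_mul; last exact: continuous_cst.
    apply: continuous_max; first exact: continuous_cst.
    by apply: continuous_min; [exact: continuous_cst | exact: continuous_id].
  + move=> s; apply: (chart_extend_inj hc hz (h1 s)); exact: ball_shift_inj.
  + move=> x; have [cx|cx] := pselect (cdom c x); last exact: chart_extend_out.
    apply: (chart_extend_fix hc) => //.
    by rewrite /ball_shift /v /cl min_r ?ler01 // maxxx mul0r scaler0 addr0.
  + move=> s x; have [cx|cx] := pselect (cdom c x); last by left; exact: chart_extend_out.
    have [c1 e1] := chart_extend_in hc hz (h1 s) cx.
    have [b0|b0] := ltrP 0 (bump z r (cfun c x) * (cl s * (r / 2))).
      right; exists c; split => //; rewrite e1 sh2.
      by have := cfun_ge0 hc cx; lra.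
    left; apply: (chart_extend_fix hc) => //; apply: injective_projections.
      exact: sh1.
    have e0 : bump z r (cfun c x) * (cl s * (r / 2)) = 0.
      by apply/eqP; rewrite eq_le b0 /=.
    by rewrite sh2 e0 addr0.
- move=> s x Ux; have [cx|cx] := pselect (cdom c x); last exact: chart_extend_out.
  apply: (chart_extend_fix hc) => //; apply: ball_shift_out => //.
  rewrite leNgt; apply/negP => h; apply: Ux; rewrite -(cinvK hc cx); apply: hU.
  by split; [exact: ltW | exact: cfun_ge0].
- move=> s x s0 [cx xr]; have [c1 e1] := chart_extend_in hc hz (h1 s) cx.
  exists c; split => //; rewrite e1 sh2.
  have := cfun_ge0 hc cx; have := bump_gt0 r0 xr.
  have : 0 < cl s by rewrite /cl lt_max lt_min ltr01 s0 orbT.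
  move=> p1 p2 p3; have : 0 < bump z r (cfun c x) * (cl s * (r / 2)).
    by rewrite mulr_gt0 // mulr_gt0 // divr_gt0.
  by lra.
- move=> s s' x hs hs' e.
  have [cy1 ey1] := chart_extend_in hc hz (h1 s') cy.
  have cx : cdom c x.
    by apply: contrapT => n; apply: n; move: cy1; rewrite -e; rewrite /chart_extend;
      case: ifPn => // /set_mem.
  have [cx1 ex1] := chart_extend_in hc hz (h1 s) cx.
  have := congr1 (cfun c) e; rewrite ex1 ey1 => e2.
  have e21 : (cfun c x).1 = z.1.
    by move/(congr1 fst) : e2; rewrite !sh1.
  move/(congr1 snd) : e2; rewrite !sh2 -/z bump_center hy add0r mul1r !clid // => e22.
  have h0 := cfun_ge0 hc cx.
  (* Above [z] the distance to [z] is the height [q], so the shift takes height [q] to at least [q +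
     (1 - q / r) * s * r / 2 = s * r / 2 + q * (1 - s / 2)], and this is not below [s * r / 2]. *)
  have hb : 1 - (cfun c x).2 / r <= bump z r (cfun c x).
    rewrite /bump le_max; apply/orP; right; rewrite prod_normE /= e21 subrr normr0 hy subr0.
    by rewrite max_r ?normr_ge0 // ger0_norm.
  set q := (cfun c x).2 in e22 h0 hb; set b := bump z r _ in e22 hb.
  move/andP: hs => [s0 s1].
  have hb2 : (1 - q / r) * (s * (r / 2)) <= b * (s * (r / 2)).
    by rewrite ler_wpM2r // mulr_ge0 // divr_ge0 // ltW.
  have hb3 : (1 - q / r) * (s * (r / 2)) = s * (r / 2) - q * s / 2.
    by field; rewrite gt_eqF.
  have r20 : 0 < r / 2 by rewrite divr_gt0.
  have : q * s <= q by rewrite ler_piMr.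
  by move=> qs; rewrite -(ler_pM2r r20) -e22; lra.
Qed.

Hypothesis hcharts : forall y, exists2 c : chart R Y, is_chart c & cdom c y.

(** Each boundary point of [K] has a push supported off [C]; by compactness finitely many of them,
    composed, move all of [K] inwards. *)
Lemma compact_push (K C : set Y) : compact K -> closed C ->
  (forall x, K x -> boundary R Y x -> ~ C x) ->
  exists N : R -> Y -> Y, [/\ inward_isotopy N,
    forall s x, C x -> N s x = x & forall x, K x -> int (N 1 x)].
Proof.
move=> cK cC KC.
have hO x : exists ON : set Y * (R -> Y -> Y), K x ->
    [/\ open ON.1 /\ ON.1 x, inward_isotopy ON.2,
      forall s u, C u -> ON.2 s u = u & forall u, ON.1 u -> int (ON.2 1 u)].
  have [Kx|] := pselect (K x); last by exists (set0, fun _ => id).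
  have [ix|ix] := pselect (int x).
    exists (int, fun _ => id) => _; split => //.
    - by split => //; exact: open_interior_point.
    - exact: inward_isotopy_id.
  have [c hc cx] := hcharts x.
  have [V [N [oV hN hC hO _]]] := boundary_push hc cx ix (closed_openC cC) (KC _ Kx ix).
  exists (V, N) => _; split => //; first by move=> s u Cu; exact: hC.
  by move=> u Ou; exact: hO.
have [ON hON] := boolp.choice hO.
have oON x : K x -> open (ON x).1 /\ (ON x).1 x by move=> /hON[].
have [l [lK hl]] := compact_finite_subcover (O := fun x => (ON x).1) cK oON.
have [N [hN NC Nl]] : exists N : R -> Y -> Y, [/\ inward_isotopy N,
    forall s x, C x -> N s x = x &
    forall x y, y \in l -> (ON y).1 x -> int (N 1 x)].
  elim: l lK {hl} => [|y l IH] lK.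
    by exists (fun _ => id); split => //; exact: inward_isotopy_id.
  have [|N [hN NC Nl]] := IH; first by move=> x xl; apply: lK; rewrite inE xl orbT.
  have [|_ hM MC MO] := hON y; first by apply: lK; rewrite inE eqxx.
  exists (fun s x => (ON y).2 s (N s x)); split.
  - exact: inward_isotopy_comp.
  - by move=> s x Cx; rewrite NC // MC.
  - move=> x u; rewrite inE => /predU1P[->|ul] Ox.
      (* Either the previous pushes leave [x] where it is, and the new one moves it inwards, or they
         have already made it interior. *)
      have [_ _ _ /(_ 1 x) [->|h]] := hN; first exact: MO.
      exact: inward_isotopy_interior.
    by apply: inward_isotopy_interior => //; exact: Nl Ox.
by exists N; split => // x /hl[y yl Ox]; exact: Nl Ox.
Qed.

End HomeoFamilies.

(** * Lifting squares in the interior to the homeomorphism group *)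

Section Lifting.
Context {R : realType} {Y : topologicalType}.
Hypothesis hY : hausdorff_space Y.

(** Extending by constants beyond an interval keeps every parameter space equal to [R] or [R * R],
    so that gluing needs no subspace topology. *)
Definition clamp (a b t : R) : R := Num.max a (Num.min b t).

Lemma continuous_clamp (S : topologicalType) (f : S -> R) a b :
  continuous f -> continuous (fun x => clamp a b (f x)).
Proof.
move=> cf; apply: continuous_max; first exact: continuous_cst.
by apply: continuous_min; first exact: continuous_cst.
Qed.

Lemma clamp_itv a b t : a <= b -> a <= clamp a b t <= b.
Proof. by move=> ab; rewrite /clamp le_max lexx /= ge_max ab ge_min lexx. Qed.

Lemma clamp_id a b t : a <= t <= b -> clamp a b t = t.
Proof. by move=> /andP[at_ tb]; rewrite /clamp min_r // max_r. Qed.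

Lemma clamp_le a m b t : m <= b -> t <= m -> clamp a m t = clamp a b t.
Proof. by move=> mb tm; rewrite /clamp !min_r //; exact: le_trans mb. Qed.

Lemma clamp_ge a m b t : a <= m -> m <= b -> m <= t -> clamp m b t = clamp a b t.
Proof.
move=> am mb mt; have h : m <= Num.min b t by rewrite le_min mb.
by rewrite /clamp !max_r //; exact: le_trans am h.
Qed.

Lemma clamp_left a b t : a <= b -> t <= a -> clamp a b t = a.
Proof. by move=> ab ta; rewrite /clamp max_l // ge_min ta orbT. Qed.

Lemma clamp_right a b t : a <= b -> b <= t -> clamp a b t = b.
Proof. by move=> ab bt; rewrite /clamp min_l // max_r. Qed.

(* A lift of F, over the rectangle [a, b] x [c, d], through the evaluation of
   homeomorphisms at a point. *)
Definition liftable (F : R -> R -> Y) (a b c d : R) :=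
  exists (Phi Psi : R * R -> Y -> Y) (x0 : Y), homeo_family (R := R) Phi Psi /\
    forall s t, Phi (s, t) x0 = F (clamp a b s) (clamp c d t).

Lemma liftable_swap F a b c d :
  liftable F a b c d -> liftable (fun s t => F t s) c d a b.
Proof.
move=> [Phi [Psi [x0 [h e]]]].
exists (fun p => Phi (p.2, p.1)), (fun p => Psi (p.2, p.1)), x0; split.
  apply: (homeo_family_pull (g := fun p : R * R => (p.2, p.1)) _ h).
  by apply: continuous_pair; [exact: continuous_snd | exact: continuous_fst].
by move=> s t; rewrite e.
Qed.

(* The homeomorphism Phi2 (m, t) \o Psi2 (m, t) = id, inserted between the two
   lifts, matches their base points along the common edge s = m. *)
Lemma liftable_glue F a m b c d : a <= m -> m <= b ->
  liftable F a m c d -> liftable F m b c d -> liftable F a b c d.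
Proof.
move=> am mb [Phi1 [Psi1 [x1 [h1 e1]]]] [Phi2 [Psi2 [x2 [h2 e2]]]].
have [_ _ k21 k22 _] := h2.
pose g1 (p : R * R) := (Num.min p.1 m, p.2).
pose gm (p : R * R) := (m, p.2).
pose g2 (p : R * R) := (Num.max p.1 m, p.2).
have c1 : continuous g1.
  apply: continuous_pair; last exact: continuous_snd.
  by apply: continuous_min; [exact: continuous_fst | exact: continuous_cst].
have cm : continuous gm.
  by apply: continuous_pair; [exact: continuous_cst | exact: continuous_snd].
have c2 : continuous g2.
  apply: continuous_pair; last exact: continuous_snd.
  by apply: continuous_max; [exact: continuous_fst | exact: continuous_cst].
have H := homeo_family_comp (homeo_family_pull c2 h2)
  (homeo_family_comp (homeo_family_inv (homeo_family_pull cm h2)) (homeo_family_pull c1 h1)).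
exists (fun t x => Phi2 (g2 t) (Psi2 (gm t) (Phi1 (g1 t) x))).
exists (fun t x => Psi1 (g1 t) (Phi2 (gm t) (Psi2 (g2 t) x))); exists x1.
split=> [//|s t]; rewrite /g1 /g2 /gm /=.
have [sm|ms] := leP s m.
  by rewrite k22 e1 (@clamp_le a m b).
rewrite e1 (@clamp_right a m m) //.
have -> : F m (clamp c d t) = Phi2 (m, t) x2 by rewrite e2 (@clamp_left m b).
by rewrite k21 e2 (@clamp_ge a m b) // ltW.
Qed.

Lemma liftable_strip F c d (e : R) : 0 < e ->
  (forall a b, 0 <= a -> a <= b -> b <= 1 -> b - a < e -> liftable F a b c d) ->
  liftable F 0 1 c d.
Proof.
move=> e0 hs; have [n] := ltr_add_invr e0; rewrite add0r => ne.
have n0 : (0 : R) < n.+1%:R by rewrite ltr0Sn.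
have h k : (k <= n.+1)%N -> liftable F 0 (k%:R / n.+1%:R) c d.
  (* The induction starts from a degenerate strip of width 0. *)
  elim: k => [_|k IH kn]; first by apply: hs; rewrite ?mul0r ?subrr ?ler01.
  have kk : k%:R / n.+1%:R <= k.+1%:R / n.+1%:R :> R.
    by rewrite ler_pM2r ?invr_gt0 // ler_nat.
  apply: (liftable_glue _ kk (IH (ltnW kn))); first by rewrite divr_ge0.
  apply: hs => //.
    by rewrite ler_pdivrMr // mul1r ler_nat.
  by rewrite -mulrBl -natrB // subSnn mul1r.
by have := h n.+1 (leqnn _); rewrite divff // gt_eqF.
Qed.

(** A Lebesgue number for the cover of the square by preimages of draggable sets. In the maximum
    norm, a rectangle with sides shorter than [e] lies in the [e]-ball around its corner
    [(a, c)]. *)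
Lemma liftable_small F : continuous (fun p : R * R => F p.1 p.2) ->
  (forall s t, interior_point R Y (F s t)) ->
  exists2 e, 0 < e & forall a b c d, 0 <= a -> a <= b -> b <= 1 -> b - a < e ->
    0 <= c -> c <= d -> d <= 1 -> d - c < e -> liftable F a b c d.
Proof.
move=> cF iF.
pose P (e : R) (x : R * R) := exists D y, draggable (R := R) D y /\
  forall x', `|x - x'| < e -> D (F x'.1 x'.2).
have cK : compact (`[0%R : R, 1] `*` `[0%R : R, 1]).
  by apply: compact_setX; exact: segment_compact.
have /compact_near_coveringP/(_ _ (0 : R)^'+ P _) := cK.
have PF : forall x, (`[0%R : R, 1] `*` `[0%R : R, 1]) x ->
    \forall x' \near x & e \near (0 : R)^'+, P e x'.
  move=> x _; have [D [oD Dx] hD] := interior_draggable hY (iF x.1 x.2).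
  have nD : nbhs x ((fun p : R * R => F p.1 p.2) @^-1` D).
    by apply: cF; exact: open_nbhs_nbhs.
  have [d d0 hd] := (nbhs_normP x _).1 nD.
  (* One half of [d] is for moving the centre from [x] to [x'], the other for the radius [e]. *)
  have d20 : 0 < d / 2 by rewrite divr_gt0.
  exists ([set x' | `|x - x'| < d / 2], [set e | e < d / 2]) => /=.
    split; last exact: nbhs_right_lt.
    by apply: (nbhs_normP x _).2; exists (d / 2).
  move=> [x' e] /= [h1 h2]; exists D, (F x.1 x.2); split=> // u hu.
  apply: hd => /=; have -> : x - u = (x - x') + (x' - u) by rewrite addrA subrK.
  apply: le_lt_trans (ler_normD _ _) _.
  by have := lt_trans hu h2; lra.
move=> /(_ PF) H.
have [e [e0 he]] := @filter_ex _ _ _ _ (filterI (nbhs_right_gt (0 : R)) H).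
exists e => // a b c d a0 ab b1 bae c0 cd d1 dce.
have [|D [y [hD DF]]] := he (a, c).
  by split; rewrite /= in_itv /=; apply/andP; split => //;
    [exact: le_trans b1 | exact: le_trans d1].
have [||Phi [Psi [h hF]]] := hD (R * R)%type (fun p => F (clamp a b p.1) (clamp c d p.2)).
- apply: (continuous_compose2 cF).
  + by apply: continuous_clamp; exact: continuous_fst.
  + by apply: continuous_clamp; exact: continuous_snd.
- move=> t; apply: (DF (clamp a b t.1, clamp c d t.2)).
  rewrite prod_normE gt_max /=.
  have /andP[h1 h2] := clamp_itv t.1 ab; have /andP[h3 h4] := clamp_itv t.2 cd.
  by apply/andP; split; rewrite ler0_norm; lra.
- by exists Phi, Psi, y; split => // s t; rewrite hF.
Qed.

Lemma liftable_unit_square F : continuous (fun p : R * R => F p.1 p.2) ->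
  (forall s t, interior_point R Y (F s t)) -> liftable F 0 1 0 1.
Proof.
move=> cF iF; have [e e0 he] := liftable_small cF iF.
apply: (liftable_swap (F := fun t s => F s t)); apply: (liftable_strip e0) => c d c0 cd d1 dce.
apply: (liftable_swap (F := F)); apply: (liftable_strip e0) => a b a0 ab b1 bae.
exact: he.
Qed.

End Lifting.

(** * Continuity of real-valued expressions *)

Section RealFunctions.
Context {R : realType} {S : topologicalType}.
Implicit Types f g : S -> R.

Lemma continuous_addr f g : continuous f -> continuous g -> continuous (fun x => f x + g x).
Proof. exact: (@continuous_add R S R). Qed.

Lemma continuous_oppr f : continuous f -> continuous (fun x => - f x).
Proof. exact: (@continuous_opp R S R). Qed.

End RealFunctions.

Ltac continuity := repeat first
  [ assumption | exact: continuous_cst | exact: continuous_id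
  | exact: continuous_fst | exact: continuous_snd
  | apply: continuous_pair | apply: continuous_clamp | apply: continuous_addr
  | apply: continuous_oppr | apply: continuous_mul | apply: continuous_max
  | apply: continuous_min | apply: continuous_normr ].

(** * Homotopies of paths *)

Section PathHomotopies.
Context {R : realType} {Y : topologicalType}.
Implicit Types f g h : R -> Y.

(* Paths are functions on R of which only the values on [0, 1] matter. *)
Definition homotopic_through (P : (R -> Y) -> Prop) f g := exists F : R -> R -> Y,
  [/\ continuous (fun p : R * R => F p.1 p.2),
      forall t, 0 <= t <= 1 -> F 0 t = f t,
      forall t, 0 <= t <= 1 -> F 1 t = g t,
      forall s, 0 <= s <= 1 -> F s 0 = f 0 /\ F s 1 = f 1 &
      forall s, 0 <= s <= 1 -> P (F s)].

Definition homotopic := homotopic_through (fun _ => True).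

Definition injective01 f :=
  forall s t, 0 <= s <= 1 -> 0 <= t <= 1 -> f s = f t -> s = t.

Definition isotopic := homotopic_through injective01.

Lemma itv01_0 : 0 <= (0 : R) <= 1. Proof. by rewrite lexx ler01. Qed.
Lemma itv01_1 : 0 <= (1 : R) <= 1. Proof. by rewrite lexx ler01. Qed.

Lemma homotopic_ends P f g : homotopic_through P f g -> g 0 = f 0 /\ g 1 = f 1.
Proof.
move=> [F [_ _ h1 he _]]; have [e0 e1] := he 1 itv01_1.
by rewrite -!h1 ?itv01_0 ?itv01_1.
Qed.

Lemma homotopic_sym P f g : homotopic_through P f g -> homotopic_through P g f.
Proof.
move=> fg; have [g0 g1] := homotopic_ends fg; have [F [cF h0 h1 he hP]] := fg.
exists (fun s t => F (1 - s) t); split.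
- by apply: (continuous_compose2 cF); continuity.
- by move=> t; rewrite subr0; exact: h1.
- by move=> t; rewrite subrr; exact: h0.
- by move=> s hs; rewrite g0 g1; apply: he; lra.
- by move=> s hs; apply: hP; lra.
Qed.

(** The two homotopies are known to agree on their common edge only for [t] in [0, 1], so [t] is
    clamped before pasting; [P] must not see the difference. *)
Lemma homotopic_through_trans (P : (R -> Y) -> Prop) g f h :
  (forall u v, (forall t, 0 <= t <= 1 -> u t = v t) -> P u -> P v) ->
  homotopic_through P f g -> homotopic_through P g h -> homotopic_through P f h.
Proof.
move=> eP fg gh; have [g0 g1] := homotopic_ends fg.
have [F [cF F0 F1 Fe FP]] := fg; have [G [cG G0 G1 Ge GP]] := gh.
exists (fun s t => if 2 * s - 1 <= 0 then F (2 * s) (clamp 0 1 t)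
                   else G (2 * s - 1) (clamp 0 1 t)); split.
- apply: (@continuous_paste R _ _ (fun p : R * R => 2 * p.1 - 1)
    (fun p => F (2 * p.1) (clamp 0 1 p.2)) (fun p => G (2 * p.1 - 1) (clamp 0 1 p.2))).
  + by continuity.
  + by apply: (continuous_compose2 cF); continuity.
  + by apply: (continuous_compose2 cG); continuity.
  + move=> p hp; rewrite hp; have -> : 2 * p.1 = 1 by lra.
    by rewrite F1 ?G0 // clamp_itv // ler01.
- by move=> t ht; rewrite ifT ?mulr0 ?F0 ?clamp_id //; lra.
- move=> t ht; rewrite ifF; last by apply/negbTE; rewrite -ltNge; lra.
  by have -> : 2 * 1 - 1 = 1 :> R by [lra]; rewrite G1 clamp_id.
- move=> s hs; rewrite !clamp_id ?itv01_0 ?itv01_1 //.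
  by case: ifPn; rewrite -?ltNge => hh; [apply: Fe; lra | rewrite -g0 -g1; apply: Ge; lra].
- move=> s hs; have [hh|hh] := leP (2 * s - 1) 0.
    apply: (eP (F (2 * s))); last by apply: FP; lra.
    by move=> t ht; rewrite clamp_id.
  apply: (eP (G (2 * s - 1))); last by apply: GP; lra.
  by move=> t ht; rewrite clamp_id.
Qed.

Lemma homotopic_trans g f h : homotopic f g -> homotopic g h -> homotopic f h.
Proof. exact: homotopic_through_trans. Qed.

Lemma isotopic_trans g f h : isotopic f g -> isotopic g h -> isotopic f h.
Proof.
apply: homotopic_through_trans => u v uv iu s t hs ht e; apply: iu => //.
by rewrite !uv.
Qed.

Lemma isotopic_homotopic f g : isotopic f g -> homotopic f g.
Proof. by move=> [F [? ? ? ? _]]; exists F. Qed.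

Lemma isotopic_injective f g : isotopic f g -> injective01 g.
Proof.
move=> [F [_ _ F1 _ Fi]] s t hs ht; rewrite -!F1 // => e.
by apply: (Fi 1) => //; exact: itv01_1.
Qed.

(** The source of all reparametrization identities below: both paths are one map [K] along two
    curves in a vector space, and these are joined by straight lines. *)
Lemma homotopic_compose_convex (V : normedModType R) (K : V -> Y) (a b : R -> V) f g :
  continuous K -> continuous a -> continuous b -> a 0 = b 0 -> a 1 = b 1 ->
  (forall t, 0 <= t <= 1 -> f t = K (a t)) ->
  (forall t, 0 <= t <= 1 -> g t = K (b t)) -> homotopic f g.
Proof.
move=> cK ca cb ab0 ab1 fK gK.
exists (fun s t => K ((1 - s) *: a t + s *: b t)); split.
- apply: (continuous_compose cK); apply: continuous_add; apply: continuous_scale.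
  + by continuity.
  + by apply: (continuous_compose ca); continuity.
  + by continuity.
  + by apply: (continuous_compose cb); continuity.
- by move=> t ht; rewrite subr0 scale1r scale0r addr0 fK.
- by move=> t ht; rewrite subrr scale1r scale0r add0r gK.
- by move=> s _; rewrite !fK ?itv01_0 ?itv01_1 // -ab0 -ab1 -!scalerDl subrK !scale1r.
- by [].
Qed.

Lemma homotopic_refl f : continuous f -> homotopic f f.
Proof. by move=> cf; exists (fun _ t => f t); split=> //; apply: (continuous_compose cf); continuity. Qed.

Definition path_cat f g : R -> Y := fun t =>
  if 2 * t - 1 <= 0 then f (2 * t) else g (2 * t - 1).

Definition path_rev f : R -> Y := fun t => f (1 - t).

Lemma continuous_path_cat f g : continuous f -> continuous g -> f 1 = g 0 ->
  continuous (path_cat f g).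
Proof.
move=> cf cg fg; apply: (@continuous_paste R _ _ (fun t : R => 2 * t - 1)
  (fun t => f (2 * t)) (fun t => g (2 * t - 1))).
- by continuity.
- by apply: (continuous_compose cf); continuity.
- by apply: (continuous_compose cg); continuity.
- by move=> t e; rewrite e; have -> : 2 * t = 1 by lra.
Qed.

Lemma continuous_path_rev f : continuous f -> continuous (path_rev f).
Proof. by move=> cf; apply: (continuous_compose cf); continuity. Qed.

Lemma path_cat0 f g : path_cat f g 0 = f 0.
Proof. by rewrite /path_cat mulr0 ifT // sub0r lerN10. Qed.

Lemma path_cat1 f g : path_cat f g 1 = g 1.
Proof.
rewrite /path_cat; have -> : 2 * 1 - 1 = 1 :> R by lra.
by rewrite ifF // leNgt ltr01.
Qed.

Lemma path_revK f : path_rev (path_rev f) = f.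
Proof. by apply/funext => t; rewrite /path_rev subKr. Qed.

Lemma path_rev0 f : path_rev f 0 = f 1.
Proof. by rewrite /path_rev subr0. Qed.

Lemma path_rev1 f : path_rev f 1 = f 0.
Proof. by rewrite /path_rev subrr. Qed.

Lemma homotopic_cat f f' g g' : f 1 = g 0 ->
  homotopic f f' -> homotopic g g' -> homotopic (path_cat f g) (path_cat f' g').
Proof.
move=> fg [F [cF F0 F1 Fe _]] [G [cG G0 G1 Ge _]].
exists (fun s t => if 2 * t - 1 <= 0 then F (clamp 0 1 s) (2 * t)
                   else G (clamp 0 1 s) (2 * t - 1)); split.
- apply: (@continuous_paste R _ _ (fun p : R * R => 2 * p.2 - 1)
    (fun p => F (clamp 0 1 p.1) (2 * p.2)) (fun p => G (clamp 0 1 p.1) (2 * p.2 - 1))).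
  + by continuity.
  + by apply: (continuous_compose2 cF); continuity.
  + by apply: (continuous_compose2 cG); continuity.
  + move=> p hp; rewrite hp; have -> : 2 * p.2 = 1 by lra.
    by rewrite (Fe _ _).2 ?(Ge _ _).1 // clamp_itv // ler01.
- move=> t ht; rewrite /path_cat clamp_id ?itv01_0 //.
  by case: ifPn; rewrite -?ltNge => hh; [rewrite F0 //; lra | rewrite G0 //; lra].
- move=> t ht; rewrite /path_cat clamp_id ?itv01_1 //.
  by case: ifPn; rewrite -?ltNge => hh; [rewrite F1 //; lra | rewrite G1 //; lra].
- move=> s hs; rewrite path_cat0 path_cat1 clamp_id //.
  rewrite mulr0 ifT ?sub0r ?lerN10 //; have -> : 2 * 1 - 1 = 1 :> R by lra.
  by rewrite ifF ?leNgt ?ltr01 // (Fe _ hs).1 (Ge _ hs).2.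
- by [].
Qed.

Lemma homotopic_cat_rev f g : continuous f -> continuous g -> f 1 = g 0 ->
  homotopic g (path_cat (path_rev f) (path_cat f g)).
Proof.
move=> cf cg fg.
pose K (t : R) := if t - 1 <= 0 then f t else g (t - 1).
have cK : continuous K.
  apply: (@continuous_paste R _ _ (fun t : R => t - 1) f (fun t => g (t - 1))) => //.
  - by continuity.
  - by apply: (continuous_compose cg); continuity.
  - by move=> t e; rewrite e; have -> : t = 1 by lra.
(* [K] runs through [f] on [0, 1] and [g] on [1, 2]. The path [g] runs from 1 to 2; the triple
   product runs from 1 back to 0 and then at double speed to 2, which is what the second formula
   describes. *)
apply: (@homotopic_compose_convex R K (fun t => 1 + t)
  (fun t => `|2 * t - 1| + Num.max 0 (2 * t - 1))) => //.
- by continuity.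
- by continuity.
- by rewrite mulr0 sub0r normrN normr1 max_l ?lerN10 // addr0.
- have -> : 2 * 1 - 1 = 1 :> R by lra.
  by rewrite normr1 max_r ?ler01.
- move=> t /andP[t0 _]; rewrite /K; have -> : 1 + t - 1 = t by lra.
  case: ifPn; rewrite -?ltNge => // hh; have -> : t = 0 by lra.
  by rewrite addr0 fg.
- move=> t ht; rewrite {1}/path_cat; case: ifPn; rewrite -?ltNge => hh.
    rewrite max_l // addr0 ler0_norm // /K /path_rev ifT; last by lra.
    by congr f; lra.
  rewrite max_r ?ltW // gtr0_norm // /path_cat /K.
  have -> : 2 * t - 1 + (2 * t - 1) = 2 * (2 * t - 1) by lra.
  by [].
Qed.

(** The two ways around the unit square from (0, 0) to (1, 1) are homotopic in the square; one of
    them begins with the side [t = 0], on which [K] is constant. *)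
Lemma homotopic_square (K : R -> R -> Y) :
  continuous (fun p : R * R => K p.1 p.2) ->
  (forall s, 0 <= s <= 1 -> K s 0 = K 1 0) ->
  homotopic (K 1) (path_cat (K 0) (fun s => K s 1)).
Proof.
move=> cK K0.
have c1 : continuous (K 1) by apply: (continuous_compose2 cK); continuity.
apply: (@homotopic_trans (path_cat (fun s => K s 0) (K 1))).
  apply: (@homotopic_compose_convex R (K 1) (fun t => t) (fun t => Num.max 0 (2 * t - 1))) => //.
  - by continuity.
  - by continuity.
  - by rewrite mulr0 sub0r max_l // lerN10.
  - have -> : 2 * 1 - 1 = 1 :> R by lra.
    by rewrite max_r ?ler01.
  - move=> t ht; rewrite /path_cat; case: ifPn; rewrite -?ltNge => hh.
      by rewrite max_l // K0 //; lra.
    by rewrite max_r // ltW.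
apply: (@homotopic_compose_convex _ (fun p : R * R => K p.1 p.2)
  (fun t => (clamp 0 1 (2 * t), clamp 0 1 (2 * t - 1)))
  (fun t => (clamp 0 1 (2 * t - 1), clamp 0 1 (2 * t)))) => //.
- by continuity.
- by continuity.
- by rewrite mulr0 sub0r clamp_id ?itv01_0 // clamp_left ?lerN10.
- have -> : 2 * 1 - 1 = 1 :> R by lra.
  by rewrite !(@clamp_right R 0 1) ?ler01 //; lra.
- move=> t ht; rewrite /path_cat /=; case: ifPn; rewrite -?ltNge => hh.
    by rewrite (@clamp_id _ _ _ (2 * t)) ?(@clamp_left _ _ _ (2 * t - 1)) //; lra.
  by rewrite (@clamp_id _ _ _ (2 * t - 1)) ?(@clamp_right _ _ _ (2 * t)) //; lra.
- move=> t ht; rewrite /path_cat /=; case: ifPn; rewrite -?ltNge => hh.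
    by rewrite (@clamp_id _ _ _ (2 * t)) ?(@clamp_left _ _ _ (2 * t - 1)) //; lra.
  by rewrite (@clamp_id _ _ _ (2 * t - 1)) ?(@clamp_right _ _ _ (2 * t)) //; lra.
Qed.

End PathHomotopies.

(** * Homotopic arcs are isotopic *)

Section HomotopicArcs.
Context {R : realType} {Y : topologicalType}.
Hypothesis hY : hausdorff_space Y.
Hypothesis hcharts : forall y, exists2 c : chart R Y, is_chart c & cdom c y.
Implicit Types f g k : R -> Y.
Let int : set Y := interior_point R Y.

Section Whisker.
Variables (p : Y) (N : R -> Y -> Y).
Hypothesis hN : inward_isotopy N.
Hypothesis hp : forall s s' x, 0 <= s <= 1 -> 0 <= s' <= 1 ->
  N s x = N s' p -> s <= s'.

(* While N_s pushes p into the interior, its trace N_u p, u <= s, joins p to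
   the displaced arc. *)
Lemma isotopic_whisker f : continuous f -> injective01 f -> f 0 = p ->
  (forall s, N s (f 1) = f 1) ->
  isotopic f (path_cat (fun t => N t p) (fun t => N 1 (f t))).
Proof.
move=> cf fi f0 Nf1; have [cN Ni N0 _] := hN.
(* The curve at time [s] is traversed by a parameter [u = t + s * t] from 0 to [1 + s]: whisker for
   [u <= s], then the displaced arc at [u - s]. *)
exists (fun s t => if t + s * t - s <= 0 then N (t + s * t) p
                   else N s (f (t + s * t - s))); split.
- apply: (@continuous_paste R _ _ (fun u : R * R => u.2 + u.1 * u.2 - u.1)
    (fun u => N (u.2 + u.1 * u.2) p) (fun u => N u.1 (f (u.2 + u.1 * u.2 - u.1)))).
  + by continuity.
  + by apply: (continuous_compose2 cN); continuity.
  + apply: (continuous_compose2 cN); first by continuity.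
    by apply: (continuous_compose cf); continuity.
  + by move=> u hu; rewrite hu f0; congr (N _ p); lra.
- move=> t ht; rewrite mul0r addr0 subr0 N0; case: ifP => // h.
  have -> : t = 0 by lra.
  by rewrite N0.
- by move=> t ht; rewrite /path_cat mul1r; have -> : 2 * t = t + t by lra.
- move=> s hs; rewrite mulr0 addr0 sub0r mulr1 addrK N0 f0.
  by rewrite ifT ?ifF ?Nf1 ?leNgt ?ltr01 //; lra.
- move=> s hs t t' ht ht'.
  have st : 0 <= s * t <= s.
    by rewrite mulr_ge0 ?ler_piMr //; lra.
  have st' : 0 <= s * t' <= s.
    by rewrite mulr_ge0 ?ler_piMr //; lra.
  have cancel_t : t + s * t = t' + s * t' -> t = t'.
    have s1 : 1 + s != 0 by rewrite gt_eqF //; lra.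
    by move=> e; apply: (mulfI s1); rewrite !mulrDl !mul1r.
  case: ifPn; rewrite -?ltNge => h; case: ifPn; rewrite -?ltNge => h'.
  + move=> e; apply: cancel_t; apply/eqP; rewrite eq_le.
    by rewrite (hp _ _ e) ?(hp _ _ (esym e)) //; lra.
  (* The whisker meets the displaced arc: [hp] forces the meeting point to be the tip [N s p], and
     injectivity of [N s] and [f] puts it at the start of the arc, against [h']. *)
  + move=> e; have := hp _ _ (esym e) => s1.
    have e1 : t + s * t = s by apply/eqP; rewrite eq_le s1; lra.
    move: e; rewrite e1 -f0 => /Ni /fi; lra.
  + move=> e; have := hp _ _ e => s1.
    have e1 : t' + s * t' = s by apply/eqP; rewrite eq_le s1; lra.
    move: e; rewrite e1 -f0 => /Ni /fi; lra.
  + move=> /Ni /fi => e; apply: cancel_t; apply: (addIr (- s)); apply: e; lra.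
Qed.

End Whisker.

Lemma isotopic_push (M : R -> Y -> Y) f g : inward_isotopy M ->
  continuous f -> injective01 f ->
  (forall s, M s (f 0) = f 0) -> (forall s, M s (f 1) = f 1) ->
  (forall t, 0 <= t <= 1 -> M 1 (f t) = g t) -> isotopic f g.
Proof.
move=> [cM Mi M0 _] cf fi M0f M1f Mg; exists (fun s t => M s (f t)); split => //.
- by apply: (continuous_compose2 cM); [continuity | apply: (continuous_compose cf); continuity].
- by move=> s _ t t' ht ht' /Mi; exact: fi.
Qed.

Section Retract.
Variables (G : R -> R -> Y) (Phi Psi : R * R -> Y -> Y) (x0 p : Y) (W : R -> Y).
Hypotheses (hPhi : homeo_family (R := R) Phi Psi).
Hypothesis PhiG : forall s t, 0 <= s <= 1 -> 0 <= t <= 1 -> Phi (s, t) x0 = G s t.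
Hypothesis bp : boundary R Y p.
Hypotheses (cW : continuous W) (W0 : W 0 = p) (W1 : forall s, 0 <= s <= 1 -> W 1 = G s 0).

(* The arc W . G s is shortened from its free end, which the homeomorphisms
   drag back to G s 1, until only a displaced copy of W is left. *)
Lemma isotopic_retract s : 0 <= s <= 1 -> continuous (G s) ->
  injective01 (path_cat W (G s)) ->
  isotopic (path_cat W (G s)) (fun t => Phi (s, 1) (Psi (s, 0) (W t))).
Proof.
move=> hs cG ui; set u := path_cat W (G s).
have [cPhi cPsi k1 k2 b] := hPhi; have [_ _ _ _ b'] := homeo_family_inv hPhi.
have cu : continuous u by apply: continuous_path_cat => //; exact: W1.
have e1 (r : R) : 0 <= r <= 1 -> u (1 - r / 2) = G s (1 - r).
  move=> hr; rewrite /u /path_cat; have -> : 2 * (1 - r / 2) - 1 = 1 - r by lra.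
  case: ifPn => // h; have -> : r = 1 by lra.
  by rewrite subrr -(W1 hs); congr W; lra.
(* The whisker fills the first half of [u], so cutting at [1 - r / 2] leaves the free end
   [G s (1 - r)]; it is taken to [x0] by [Psi (s, 1 - r)] and on to [G s 1] by [Phi (s, 1)]. *)
exists (fun r t => Phi (s, 1) (Psi (s, 1 - r) (u (t * (1 - r / 2))))); split.
- apply: (continuous_compose2 cPhi); first by continuity.
  apply: (continuous_compose2 cPsi); first by continuity.
  by apply: (continuous_compose cu); continuity.
- by move=> t ht; rewrite mul0r !subr0 mulr1 k2.
- move=> t ht; rewrite subrr; congr (Phi _ (Psi _ _)).
  by rewrite /u /path_cat ifT; [congr W; lra | lra].
- move=> r hr; rewrite mul0r mul1r e1 //; split.
    by rewrite /u path_cat0 W0 b' // b.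
  rewrite -PhiG //; last by lra.
  by rewrite k1 PhiG ?itv01_1 // /u path_cat1.
- move=> r hr t t' ht ht' /(can_inj (k1 _)) /(can_inj (k2 _)) /ui e.
  have r0 : 1 - r / 2 != 0 by rewrite gt_eqF //; lra.
  by apply: (mulIf r0); apply: e; rewrite mulr_ge0 ?mulr_ile1 //; lra.
Qed.

(** The tip [W 1 = G s 0] goes to [x0] and then to [G s 1], which does not depend on [s].
    Injectivity is required of [W] only, not of the curves [G s]. *)
Lemma isotopic_slide : injective01 W -> (forall s, 0 <= s <= 1 -> G s 1 = G 0 1) ->
  isotopic (fun t => Phi (0, 1) (Psi (0, 0) (W t)))
           (fun t => Phi (1, 1) (Psi (1, 0) (W t))).
Proof.
move=> Wi G1; have [cPhi cPsi k1 k2 b] := hPhi; have [_ _ _ _ b'] := homeo_family_inv hPhi.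
exists (fun s t => Phi (s, 1) (Psi (s, 0) (W t))); split => //.
- apply: (continuous_compose2 cPhi); first by continuity.
  apply: (continuous_compose2 cPsi); first by continuity.
  by apply: (continuous_compose cW); continuity.
- move=> s hs; split; first by rewrite W0 !b' // !b.
  rewrite {1}(W1 hs) (W1 itv01_0) -!PhiG ?itv01_0 ?itv01_1 //.
  by rewrite !k1 !PhiG ?itv01_0 ?itv01_1 // G1.
- by move=> s hs t t' ht ht' /(can_inj (k1 _)) /(can_inj (k2 _)) /Wi; apply.
Qed.

End Retract.

Theorem homotopic_arcs_isotopic f k : continuous f -> continuous k ->
  injective01 f -> injective01 k -> boundary R Y (f 0) -> int (f 1) ->
  homotopic f k -> isotopic f k.
Proof.
move=> cf ck fi ki bp iq hfk; have [k0 k1] := homotopic_ends hfk.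
have [F [cF F0 F1 Fe _]] := hfk; set p := f 0 in bp Fe k0; set q := f 1 in iq Fe k1.
have closed1 (x : Y) : closed [set x].
  exact: accessible_closed_set1 (hausdorff_accessible hY) x.
have pq : p <> q by move=> e; apply: bp; rewrite e.
have [c hc cp] := hcharts p.
have [V [N [[_ Vp] hN NU Nint hp]]] := boundary_push hY hc cp bp (closed_openC (closed1 q)) pq.
have Nq r : N r q = q by apply: NU; apply.
have [cN Ni N0 _] := hN.
pose W (t : R) := N t p.
have cW : continuous W by apply: (continuous_compose2 cN); continuity.
have Wi : injective01 W.
  move=> t t' ht ht' e; apply/eqP; rewrite eq_le.
  by rewrite (hp _ _ _ ht ht' e) (hp _ _ _ ht' ht (esym e)).
pose Q : set (R * R) := `[0%R : R, 1] `*` `[0%R : R, 1].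
have cQ : compact Q by apply: compact_setX; exact: segment_compact.
pose K : set Y := (fun u : R * R => N 1 (F u.1 u.2)) @` Q.
(* The second push must hold the whisker and the endpoint [q] fixed while it moves the displaced
   homotopy into the interior. *)
pose C : set Y := [set q] `|` W @` `[0%R : R, 1].
have cK : compact K.
  apply: continuous_compact => //; apply: continuous_subspaceT.
  by apply: (continuous_compose2 cN); [continuity | exact: cF].
have cC : closed C.
  apply: closedU; first exact: closed1.
  apply: compact_closed => //; apply: continuous_compact; last exact: segment_compact.
  exact: continuous_subspaceT.
have KC x : K x -> boundary R Y x -> ~ C x.
  move=> [u _ <-] bx [/= e|[t ht e]]; first by apply: bx; rewrite e.
  have {}ht : 0 <= t <= 1 by move: ht; rewrite /= in_itv.
  (* By [hp], the surface displaced by [N 1] meets the whisker at its tip only, and the tip is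
     interior. *)
  have t1 : t = 1.
    by apply/eqP; rewrite eq_le (hp _ _ _ itv01_1 ht (esym e)) andbT; lra.
  by apply: bx; rewrite -e t1; exact: Nint.
have [M [hM MC MK]] := compact_push hY hcharts cK cC KC.
have [cM Mi M0 _] := hM.
pose G s t := M 1 (N 1 (F (clamp 0 1 s) (clamp 0 1 t))).
have cG : continuous (fun u : R * R => G u.1 u.2).
  apply: (continuous_compose2 cM); first by continuity.
  apply: (continuous_compose2 cN); first by continuity.
  by apply: (continuous_compose2 cF); continuity.
have iG s t : int (G s t).
  apply: MK; exists (clamp 0 1 s, clamp 0 1 t) => //.
  by split; rewrite /= in_itv /=; exact: clamp_itv.
have MW s t : 0 <= t <= 1 -> M s (W t) = W t.
  by move=> ht; apply: MC; right; exists t => //=; rewrite in_itv.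
have Mq s : M s q = q by apply: MC; left.
have Gs0 s : 0 <= s <= 1 -> W 1 = G s 0.
  by move=> hs; rewrite /G !clamp_id ?itv01_0 // (Fe _ hs).1 MW ?itv01_1.
have Gs1 s : 0 <= s <= 1 -> G s 1 = q.
  by move=> hs; rewrite /G !clamp_id ?itv01_1 // (Fe _ hs).2 Nq Mq.
have cGs s : continuous (G s) by apply: (continuous_compose2 cG); continuity.
have [Phi [Psi [x0 [hPhi ePhi]]]] := liftable_unit_square hY cG iG.
have PhiG s t : 0 <= s <= 1 -> 0 <= t <= 1 -> Phi (s, t) x0 = G s t.
  by move=> hs ht; rewrite ePhi !clamp_id.
(* Applied to [f] at [s = 0] and to [k] at [s = 1], where the curve of the homotopy is an arc. *)
have arc_to_whisker s g : 0 <= s <= 1 -> continuous g -> injective01 g ->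
    g 0 = p -> g 1 = q -> (forall t, 0 <= t <= 1 -> F s t = g t) ->
    isotopic g (fun t => Phi (s, 1) (Psi (s, 0) (W t))).
  move=> hs cg gi g0 g1 Fg.
  have gG : isotopic g (path_cat W (G s)).
    have i1 : isotopic g (path_cat W (fun t => N 1 (g t))).
      by apply: isotopic_whisker => // r; rewrite g1.
    apply: (isotopic_trans i1); apply: (isotopic_push hM).
    - apply: continuous_path_cat => //; last by rewrite g0.
      by apply: (continuous_compose2 cN); continuity.
    - exact: isotopic_injective i1.
    - by move=> r; rewrite path_cat0 MW ?itv01_0.
    - by move=> r; rewrite path_cat1 g1 Nq Mq.
    - move=> t ht; rewrite /path_cat; case: ifPn; rewrite -?ltNge => h.
        by rewrite MW //; lra.
      by rewrite /G (clamp_id hs) clamp_id ?Fg //; lra.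
  apply: (isotopic_trans gG).
  apply: (isotopic_retract hPhi PhiG bp cW (N0 _) Gs0 hs (cGs _)).
  exact: isotopic_injective gG.
apply: (isotopic_trans (arc_to_whisker 0 f itv01_0 cf fi erefl erefl F0)).
have slide : isotopic (fun t => Phi (0, 1) (Psi (0, 0) (W t)))
    (fun t => Phi (1, 1) (Psi (1, 0) (W t))).
  apply: (isotopic_slide hPhi PhiG bp cW (N0 _) Gs0 Wi) => s hs.
  by rewrite !Gs1 ?itv01_0.
apply: (isotopic_trans slide); apply: homotopic_sym.
exact: (arc_to_whisker 1 k itv01_1).
Qed.

End HomotopicArcs.

(** * The unit interval as a space and as a set of reals *)

Section UnitInterval.
Context {R : realType}.

Definition of_I01 (i : I01 R) : R := \val i.

Lemma of_I01_itv i : 0 <= of_I01 i <= 1.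
Proof. by have := set_valP i; rewrite /= in_itv. Qed.

Lemma clamp01_mem (t : R) : clamp 0 1 t \in (`[0%R, 1%R]%classic : set R).
Proof. by rewrite inE /= in_itv /= clamp_itv // ler01. Qed.

Definition to_I01 (t : R) : I01 R := exist _ (clamp 0 1 t) (clamp01_mem t).

Lemma of_I01K : cancel of_I01 to_I01.
Proof. by move=> i; apply: val_inj; rewrite /= clamp_id // of_I01_itv. Qed.

Lemma to_I01K t : 0 <= t <= 1 -> of_I01 (to_I01 t) = t.
Proof. exact: clamp_id. Qed.

Lemma of_I01_inj : injective of_I01.
Proof. exact: can_inj of_I01K. Qed.

Lemma to_I01_0 : to_I01 0 = zero.
Proof. by apply: val_inj; rewrite /= clamp_id // itv01_0. Qed.

Lemma to_I01_1 : to_I01 1 = one.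
Proof. by apply: val_inj; rewrite /= clamp_id // itv01_1. Qed.

Lemma continuous_of_I01 : continuous of_I01.
Proof. exact: initial_continuous. Qed.

Lemma continuous_to_I01 : continuous to_I01.
Proof.
apply: continuous_comp_initial.
by apply: continuous_clamp; exact: continuous_id.
Qed.

Lemma compact_I01 : compact [set: I01 R].
Proof.
have -> : [set: I01 R] = to_I01 @` `[0%R, 1%R].
  apply/seteqP; split => // i _; exists (of_I01 i); last exact: of_I01K.
  by rewrite /= in_itv; exact: of_I01_itv.
apply: continuous_compact; last exact: segment_compact.
by apply: continuous_subspaceT; exact: continuous_to_I01.
Qed.

End UnitInterval.

(** * Paths and arcs parametrized by real functions *)

Section PathsAndArcs.
Context {R : realType} {Y : topologicalType}.
Hypothesis hY : hausdorff_space Y.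
Implicit Types (p q : Y) (f g : R -> Y) (A B : set Y).

Definition real_path p q (f : {path (I01 R) from p to q}) : R -> Y := fun t => f (to_I01 t).

Lemma continuous_real_path p q (f : {path (I01 R) from p to q}) : continuous (real_path f).
Proof.
by apply: (@continuous_compose _ _ _ f); [exact: cts_fun | exact: continuous_to_I01].
Qed.

Lemma real_path0 p q (f : {path (I01 R) from p to q}) : real_path f 0 = p.
Proof. by rewrite /real_path to_I01_0 path_zero. Qed.

Lemma real_path1 p q (f : {path (I01 R) from p to q}) : real_path f 1 = q.
Proof. by rewrite /real_path to_I01_1 path_one. Qed.

Lemma real_path_exists p q f : continuous f -> f 0 = p -> f 1 = q ->
  exists u : {path (I01 R) from p to q}, forall t, 0 <= t <= 1 -> real_path u t = f t.
Proof.
move=> cf f0 f1.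
have cu : continuous (fun i : I01 R => f (of_I01 i)).
  by apply: (continuous_compose cf); exact: continuous_of_I01.
have u0 : f (of_I01 zero) = p by rewrite -f0 -to_I01_0 to_I01K // itv01_0.
have u1 : f (of_I01 one) = q by rewrite -f1 -to_I01_1 to_I01K // itv01_1.
exists (mk_path cu u0 u1) => t ht.
by rewrite /real_path /= /mk_path to_I01K.
Qed.

Lemma path_homotopicP p q (u v : {path (I01 R) from p to q}) :
  path_homotopic u v <-> homotopic (real_path u) (real_path v).
Proof.
split=> [[F [cF F0 F1 Fp Fq]]|[F [cF F0 F1 Fe _]]].
  exists (fun s t => F (to_I01 s, to_I01 t)); split => //.
  - apply: (continuous_compose cF); apply: continuous_pair.
      by apply: (continuous_compose continuous_to_I01); exact: continuous_fst.
    by apply: (continuous_compose continuous_to_I01); exact: continuous_snd.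
  - by move=> t ht; rewrite to_I01_0 F0.
  - by move=> t ht; rewrite to_I01_1 F1.
  - by move=> s hs; rewrite real_path0 real_path1 to_I01_0 to_I01_1 Fp Fq.
exists (fun x => F (of_I01 x.1) (of_I01 x.2)); split.
- apply: (continuous_compose2 cF).
    by apply: (continuous_compose continuous_of_I01); exact: continuous_fst.
  by apply: (continuous_compose continuous_of_I01); exact: continuous_snd.
- by move=> t; rewrite -to_I01_0 to_I01K ?itv01_0 // F0 ?of_I01_itv // /real_path of_I01K.
- by move=> t; rewrite -to_I01_1 to_I01K ?itv01_1 // F1 ?of_I01_itv // /real_path of_I01K.
- move=> s; rewrite -to_I01_0 to_I01K ?itv01_0 // (Fe _ (of_I01_itv s)).1.
  exact: real_path0.
- move=> s; rewrite -to_I01_1 to_I01K ?itv01_1 // (Fe _ (of_I01_itv s)).2.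
  exact: real_path1.
Qed.

Lemma homotopy_class_eq p q (u v : {path (I01 R) from p to q}) :
  homotopy_class u = homotopy_class v <-> homotopic (real_path u) (real_path v).
Proof.
split=> [e|uv].
  have : homotopy_class v v.
    by apply/path_homotopicP; apply: homotopic_refl; exact: continuous_real_path.
  by rewrite -e => /path_homotopicP.
apply/seteqP; split => w /path_homotopicP h; apply/path_homotopicP.
  by apply: homotopic_trans h; exact: homotopic_sym.
exact: homotopic_trans h.
Qed.

Lemma embedding_of_I01 (u : I01 R -> Y) : continuous u -> injective u ->
  topological_embedding u.
Proof.
move=> cu iu; split => // U; split => [oU|[V oV <-]]; last first.
  by apply: open_comp => // x _; exact: cu.
exists (~` (u @` ~` U)).
  apply: closed_openC; apply: compact_closed => //.
  apply: continuous_compact; first exact: continuous_subspaceT.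
  apply: subclosed_compact compact_I01 _ => //; exact: open_closedC.
apply/seteqP; split => i /=; first by move=> h; apply: contrapT => n; apply: h; exists i.
by move=> Ui [j nj /iu e]; apply: nj; rewrite e.
Qed.

Lemma continuous_embedding (S T : topologicalType) (u : S -> T) :
  topological_embedding u -> continuous u.
Proof. by move=> [_ h]; apply/continuousP => V oV; apply/h; exists V. Qed.

Definition real_arc p q f := [/\ continuous f, injective01 f, f 0 = p & f 1 = q].

Definition trace f : set Y := f @` `[0%R, 1%R].

Lemma traceE (u : I01 R -> Y) : trace (u \o to_I01) = range u.
Proof.
apply/seteqP; split => [_ [t _ <-]|_ [i _ <-]]; first by exists (to_I01 t).
exists (of_I01 i); last by rewrite /= of_I01K.
by rewrite /= in_itv; exact: of_I01_itv.
Qed.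

Lemma trace_eq f g : (forall t, 0 <= t <= 1 -> f t = g t) -> trace f = trace g.
Proof.
by move=> fg; apply: eq_imagel => t; rewrite /= in_itv; exact: fg.
Qed.

Lemma real_arc_param p q (u : I01 R -> Y) : arc_param p q u -> real_arc p q (u \o to_I01).
Proof.
move=> [eu u0 u1]; split.
- by apply: (continuous_compose (continuous_embedding eu)); exact: continuous_to_I01.
- move=> s t hs ht /= /eu.1 /(congr1 of_I01).
  by rewrite !to_I01K.
- by rewrite /= to_I01_0.
- by rewrite /= to_I01_1.
Qed.

Lemma arc_param_real p q f : real_arc p q f -> arc_param p q (f \o of_I01).
Proof.
move=> [cf fi f0 f1]; split.
- apply: embedding_of_I01.
    by apply: (continuous_compose cf); exact: continuous_of_I01.
  by move=> i j /= /fi h; apply: of_I01_inj; apply: h; exact: of_I01_itv.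
- by rewrite /= -f0 -to_I01_0 to_I01K // itv01_0.
- by rewrite /= -f1 -to_I01_1 to_I01K // itv01_1.
Qed.

Lemma trace_real f : range (f \o of_I01) = trace f.
Proof. by rewrite -traceE; apply: trace_eq => t ht /=; rewrite to_I01K. Qed.

Lemma is_arcP p q A : is_arc R p q A <-> exists2 f, real_arc p q f & A = trace f.
Proof.
split=> [[u hu ->]|[f hf ->]].
  by exists (u \o to_I01); [exact: real_arc_param | rewrite traceE].
by exists (f \o of_I01); [exact: arc_param_real | rewrite trace_real].
Qed.

(** Isotopy classes consist of subsets, so the choice of parametrization must be harmless. The
    change of parameter [th], the inverse of [g] after [f], is continuous because [g] is an
    embedding, and increasing because it is injective with ends 0 and 1. Convex combinations of [th]
    with the identity are again strictly increasing. *)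
Lemma reparametrization_isotopic p q f g : real_arc p q f -> real_arc p q g ->
  trace f = trace g -> isotopic f g.
Proof.
move=> [cf fi f0 f1] [cg gi g0 g1] fg.
have [eg _ _] := arc_param_real (And4 cg gi g0 g1).
have hth t : exists i : I01 R, g (of_I01 i) = f (clamp 0 1 t).
  have : trace g (f (clamp 0 1 t)).
    rewrite -fg; exists (clamp 0 1 t) => //=.
    by rewrite in_itv /= clamp_itv // ler01.
  move=> [u hu e]; exists (to_I01 u); rewrite to_I01K.
    by move: e.
  by move: hu; rewrite /= in_itv.
have [th0 thP] := boolp.choice hth.
pose th t := of_I01 (th0 t).
have cth : continuous th.
  apply: (continuous_compose continuous_of_I01); apply/continuousP => U /eg.2 [V oV VU].
  have -> : th0 @^-1` U = (fun t => f (clamp 0 1 t)) @^-1` V.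
    by rewrite -VU; apply/seteqP; split => t /=; rewrite thP.
  apply: open_comp => // t _; apply: (continuous_compose cf).
  by apply: continuous_clamp; exact: continuous_id.
have th01 t : 0 <= th t <= 1 by exact: of_I01_itv.
have gth t : 0 <= t <= 1 -> g (th t) = f t by move=> ht; rewrite /th thP clamp_id.
have th_0 : th 0 = 0.
  by apply: gi; rewrite ?itv01_0 // gth ?itv01_0 // f0 g0.
have th_1 : th 1 = 1.
  by apply: gi; rewrite ?itv01_1 // gth ?itv01_1 // f1 g1.
have th_mono : {in `[0, 1] &, {mono th : x y / x <= y}}.
  apply: itv_continuous_inj_le.
  - by exists 0, 1; rewrite !in_itv /= th_0 th_1 !lexx !ler01 ltr01; split.
  - exact: continuous_subspaceT.
  - move=> s t; rewrite !in_itv /= => hs ht e; apply: fi => //.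
    by rewrite -!gth // e.
have conv s t : 0 <= s <= 1 -> 0 <= t <= 1 -> 0 <= (1 - s) * th t + s * t <= 1.
  by move=> hs ht; have := th01 t => h; apply/andP; split; nra.
exists (fun s t => g ((1 - s) * th t + s * t)); split.
- apply: (continuous_compose cg); continuity.
  by apply: (continuous_compose cth); exact: continuous_snd.
- by move=> t ht; rewrite subr0 mul1r mul0r addr0 gth.
- by move=> t ht; rewrite subrr mul0r mul1r add0r.
- by move=> s hs; rewrite th_0 th_1 !mulr0 addr0 !mulr1 subrK g0 g1 f0 f1.
- move=> s hs t t' ht ht' /gi e; have {}e := e (conv _ _ hs ht) (conv _ _ hs ht').
  have lt_th u v : 0 <= u <= 1 -> 0 <= v <= 1 -> u < v ->
      (1 - s) * th u + s * u < (1 - s) * th v + s * v.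
    move=> hu hv uv.
    have thuv : th u < th v by rewrite ltNge th_mono -?ltNge // in_itv.
    have [s0|s0] := ltP 0 s; last by have -> : s = 0 by [lra]; lra.
    have : 0 < s * (v - u) by rewrite mulr_gt0 // subr_gt0.
    have : 0 <= (1 - s) * (th v - th u) by rewrite mulr_ge0 //; lra.
    by lra.
  have [tt|tt|//] := ltgtP t t'.
    by have := lt_th _ _ ht ht' tt; rewrite e ltxx.
  by have := lt_th _ _ ht' ht tt; rewrite e ltxx.
Qed.

Lemma arc_isotopicP p q A B : arc_isotopic R p q A B <->
  exists f g, [/\ real_arc p q f, real_arc p q g, A = trace f, B = trace g & isotopic f g].
Proof.
split=> [[F [cF hF -> ->]]|[f [g [hf hg -> -> [F [cF F0 F1 Fe Fi]]]]]].
  exists (fun t => F (zero, to_I01 t)), (fun t => F (one, to_I01 t)); split.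
  - exact: (real_arc_param (hF zero)).
  - exact: (real_arc_param (hF one)).
  - exact/esym/traceE.
  - exact/esym/traceE.
  - exists (fun s t => F (to_I01 s, to_I01 t)); split.
    + apply: (continuous_compose cF); apply: continuous_pair.
        by apply: (continuous_compose continuous_to_I01); exact: continuous_fst.
      by apply: (continuous_compose continuous_to_I01); exact: continuous_snd.
    + by move=> t ht; rewrite to_I01_0.
    + by move=> t ht; rewrite to_I01_1.
    + move=> s hs; have [_ e0 e1] := hF (to_I01 s); have [_ e0' e1'] := hF zero.
      by rewrite to_I01_0 to_I01_1 e0 e1 e0' e1'.
    + by move=> s hs; have [_ inj_s _ _] := real_arc_param (hF (to_I01 s)).
have [_ _ f0 f1] := hf.
have Fs s : real_arc p q (F (of_I01 s)).
  have [e0 e1] := Fe _ (of_I01_itv s); split; [|exact: Fi (of_I01_itv s)| |].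
  - by apply: (continuous_compose2 cF); continuity.
  - by rewrite e0.
  - by rewrite e1.
have Tr s h : (forall t, 0 <= t <= 1 -> F (of_I01 s) t = h t) ->
    trace h = range (fun t => F (of_I01 s) (of_I01 t)).
  by move=> Fh; rewrite -(trace_eq Fh) -trace_real.
exists (fun x => F (of_I01 x.1) (of_I01 x.2)); split.
- apply: (continuous_compose2 cF).
    by apply: (continuous_compose continuous_of_I01); exact: continuous_fst.
  by apply: (continuous_compose continuous_of_I01); exact: continuous_snd.
- by move=> s; exact: arc_param_real (Fs s).
- by apply: Tr => t ht; rewrite -to_I01_0 to_I01K ?itv01_0 // F0.
- by apply: Tr => t ht; rewrite -to_I01_1 to_I01K ?itv01_1 // F1.
Qed.

Lemma arc_isotopic_params p q f g : real_arc p q f -> real_arc p q g ->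
  arc_isotopic R p q (trace f) (trace g) -> isotopic f g.
Proof.
move=> hf hg /arc_isotopicP[f' [g' [hf' hg' ff' gg' i]]].
apply: (isotopic_trans (reparametrization_isotopic hf hf' ff')).
apply: (isotopic_trans i).
exact: reparametrization_isotopic hg' hg (esym gg').
Qed.

Lemma isotopy_class_eq p q f g : real_arc p q f -> real_arc p q g ->
  isotopy_class R p q (trace f) = isotopy_class R p q (trace g) <-> isotopic f g.
Proof.
move=> hf hg; split=> [e|fg].
  have : isotopy_class R p q (trace g) (trace g).
    by apply/arc_isotopicP; exists g, g; split => //; exact: (reparametrization_isotopic hg hg).
  by rewrite -e; exact: arc_isotopic_params.
apply/seteqP; split => B /arc_isotopicP[f' [g' [hf' hg' ff' -> i]]].
  apply/arc_isotopicP; exists g, g'; split => //.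
  apply: (isotopic_trans (homotopic_sym fg)); apply: isotopic_trans i.
  exact: (reparametrization_isotopic hf hf').
apply/arc_isotopicP; exists f, g'; split => //.
by apply: (isotopic_trans fg); apply: isotopic_trans i; exact: (reparametrization_isotopic hg hf').
Qed.

End PathsAndArcs.

(** * Point pushing *)

Section PointPushing.
Context {R : realType} {Y : topologicalType}.
Hypothesis hY : hausdorff_space Y.
Hypothesis hcharts : forall y, exists2 c : chart R Y, is_chart c & cdom c y.
Variables p1 p2 : Y.
Hypotheses (bp1 : boundary R Y p1) (ip2 : interior_point R Y p2).

Lemma homotopic_pushed_arc (u : {path (I01 R) from p2 to p2}) h f :
  point_pushing_map u h -> real_arc p1 p2 f ->
  real_arc p1 p2 (h \o f) /\ homotopic (h \o f) (path_cat f (real_path u)).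
Proof.
move=> [H [[cH hH H0 Hb] Hu ->]] [cf fi f0 f1].
have cK : continuous (fun x : R * R => H (to_I01 x.1, f x.2)).
  apply: (continuous_compose cH); apply: continuous_pair.
    by apply: (continuous_compose continuous_to_I01); exact: continuous_fst.
  by apply: (continuous_compose cf); exact: continuous_snd.
have H1p : H (one, p2) = p2 by rewrite Hu path_one.
split.
  split.
  - apply: (continuous_compose cH); apply: continuous_pair => //; exact: continuous_cst.
  - move=> s t hs ht e; apply: fi => //.
    by have [g [gK _ _ _]] := hH one; exact: (can_inj gK).
  - by rewrite /= f0 Hb.
  - by rewrite /= f1.
have Kc s : 0 <= s <= 1 -> H (to_I01 s, f 0) = H (to_I01 1, f 0).
  by move=> _; rewrite f0 !Hb.
have := homotopic_square (K := fun s t => H (to_I01 s, f t)) cK Kc.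
rewrite to_I01_0 to_I01_1.
have -> : (fun t => H (zero, f t)) = f by apply/funext => t; rewrite H0.
by have -> : (fun s => H (to_I01 s, f 1)) = real_path u by apply/funext => t; rewrite f1 Hu.
Qed.

Lemma point_pushing_exists (u : {path (I01 R) from p2 to p2}) :
  exists (v : {path (I01 R) from p2 to p2}) h,
    homotopic (real_path u) (real_path v) /\ point_pushing_map v h.
Proof.
have cu := @continuous_real_path R Y p2 p2 u.
have [u0 u1] := (real_path0 u, real_path1 u).
pose K : set Y := real_path u @` `[0%R, 1%R].
have cK : compact K.
  by apply: continuous_compact; [exact: continuous_subspaceT | exact: segment_compact].
have c2 : closed [set p2] by exact: accessible_closed_set1 (hausdorff_accessible hY) p2.
have Kp x : K x -> boundary R Y x -> ~ [set p2] x.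
  by move=> _ bx /= e; apply: bx; rewrite e.
have [M [hM Mp MK]] := compact_push hY hcharts cK c2 Kp.
have [cM _ M0 _] := hM.
have {}Mp s : M s p2 = p2 by exact: Mp.
have cv : continuous (fun t => M 1 (real_path u t)).
  by apply: (continuous_compose2 cM); [exact: continuous_cst | exact: cu].
have [v vM] : exists v : {path (I01 R) from p2 to p2},
    forall t, 0 <= t <= 1 -> real_path v t = M 1 (real_path u t).
  by apply: real_path_exists => //; rewrite ?u0 ?u1 Mp.
have cG : continuous (fun x : R * R => M 1 (real_path u (clamp 0 1 x.2))).
  apply: (continuous_compose cv).
  by apply: continuous_clamp; exact: continuous_snd.
have iG (s t : R) : interior_point R Y (M 1 (real_path u (clamp 0 1 t))).
  apply: MK; exists (clamp 0 1 t) => //.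
  by rewrite /= in_itv /= clamp_itv // ler01.
(* A path is lifted as a square that is constant in its first parameter. *)
have [Phi [Psi [x0 [hPhi PhiG]]]] :=
  liftable_unit_square hY (F := fun _ t => M 1 (real_path u (clamp 0 1 t))) cG iG.
have [cPhi cPsi k1 k2 b] := hPhi; have [_ _ _ _ b'] := homeo_family_inv hPhi.
have Phiv i : Phi (0, of_I01 i) x0 = v i.
  rewrite PhiG !clamp_id ?of_I01_itv // -vM ?of_I01_itv //.
  by rewrite /real_path of_I01K.
have of0 : of_I01 zero = 0 :> R by rewrite -to_I01_0 to_I01K // itv01_0.
have Psi0 : Psi (0, 0) p2 = x0.
  have <- : Phi (0, 0) x0 = p2 by rewrite -of0 Phiv path_zero.
  exact: k1.
(* The lift starts at [Phi (0, 0)], which need not be the identity; precomposing with its inverse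
   corrects this and moves the base point from [x0] to [p2]. *)
pose H (x : I01 R * Y) := Phi (0, of_I01 x.1) (Psi (0, 0) x.2).
have c0 (Z : topologicalType) (z : R * R) : continuous (fun _ : Z => z) by exact: continuous_cst.
exists v, (fun x => H (one, x)); split.
  exists (fun s t => M s (real_path u t)); split => //.
  - apply: (continuous_compose2 cM); first exact: continuous_fst.
    by apply: (continuous_compose cu); exact: continuous_snd.
  - by move=> t ht; rewrite vM.
  - by move=> s _; rewrite u0 u1 Mp.
exists H; split => //; last by move=> i; rewrite /H /= Psi0 Phiv.
split.
- apply: (continuous_compose2 cPhi).
    apply: continuous_pair; first exact: continuous_cst.
    by apply: (continuous_compose continuous_of_I01); exact: continuous_fst.
  by apply: (continuous_compose2 cPsi); [exact: c0 | exact: continuous_snd].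
- move=> i; exists (fun x => Phi (0, 0) (Psi (0, of_I01 i) x)); split.
  + by move=> x; rewrite /H /= k1 k2.
  + by move=> x; rewrite /H /= k1 k2.
  + rewrite /H /=; apply: (continuous_compose2 cPhi); first exact: c0.
    by apply: (continuous_compose2 cPsi); [exact: c0 | exact: continuous_id].
  + apply: (continuous_compose2 cPhi); first exact: c0.
    by apply: (continuous_compose2 cPsi); [exact: c0 | exact: continuous_id].
- by move=> x; rewrite /H /= of0 k2.
- by move=> i x bx; rewrite /H /= b' // b.
Qed.

Lemma image_trace (h : Y -> Y) f : h @` trace f = trace (R := R) (h \o f).
Proof. by rewrite /trace image_comp. Qed.

Theorem point_pushing_bijection a : arc_classes R p1 p2 a ->
  exists2 push : set {path (I01 R) from p2 to p2} -> set (set Y),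
    (forall g, pi1 R p2 g -> forall b, pushes_to p1 g a b <-> b = push g) &
    set_bij (pi1 R p2) (arc_classes R p1 p2) push.
Proof.
move=> [_ /(is_arcP hY)[f0 hf0 ->] ea].
rewrite -{}ea {a}; set a := isotopy_class _ _ _ _.
(* Any representative of [a] is parametrized by an arc homotopic to [f0], so the choice of
   representative in [pushes_to] does not matter. *)
have af A : a A -> exists f, [/\ real_arc p1 p2 f, homotopic f0 f & A = trace f].
  move=> /(arc_isotopicP hY)[f [g [hf hg e -> fg]]]; exists g; split => //.
  apply: isotopic_homotopic; apply: isotopic_trans fg.
  exact: (reparametrization_isotopic hY hf0 hf e).
have af0 : a (trace f0).
  by apply/(arc_isotopicP hY); exists f0, f0; split => //; exact: (reparametrization_isotopic hY hf0 hf0).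
have mk (f g : R -> Y) : real_arc p1 p2 f -> real_arc p1 p2 g -> homotopic f g ->
    isotopy_class R p1 p2 (trace f) = isotopy_class R p1 p2 (trace g).
  move=> hf hg fg; apply: (isotopy_class_eq hY hf hg).2.
  have [cf fi e0 e1] := hf; have [cg gi _ _] := hg.
  by apply: (homotopic_arcs_isotopic hY hcharts) => //; rewrite ?e0 ?e1.
(* This reduces pushing to homotopy classes of paths: what remains is algebra with concatenation. *)
have pushP (u : {path (I01 R) from p2 to p2}) b :
    pushes_to p1 (homotopy_class u) a b <->
    exists2 f, real_arc p1 p2 f /\ homotopic f (path_cat f0 (real_path u)) &
      b = isotopy_class R p1 p2 (trace f).
  split=> [[v [h [A [/path_homotopicP uv hv /af[f [hf f0f ->]] ->]]]]|[f [hf fu] ->]].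
    have [hhf hfv] := homotopic_pushed_arc hv hf; exists (h \o f); last by rewrite image_trace.
    split => //; apply: (homotopic_trans hfv); have [_ _ _ f1] := hf.
    apply: homotopic_cat; first by rewrite f1 real_path0.
      exact: homotopic_sym.
    exact: homotopic_sym.
  have [v [h [uv hv]]] := point_pushing_exists u.
  have [hhf hfv] := homotopic_pushed_arc hv hf0.
  exists v, h, (trace f0); split => //; first exact/path_homotopicP.
  rewrite image_trace; apply: mk => //; apply: (homotopic_trans fu).
  apply: homotopic_sym; apply: (homotopic_trans hfv); have [cf0 _ _ f1] := hf0.
  apply: homotopic_cat; first by rewrite f1 real_path0.
    exact: homotopic_refl.
  exact: homotopic_sym.
have [cf0 _ f00 f01] := hf0.
have pushE g : pi1 R p2 g -> exists b, pushes_to p1 g a b.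
  move=> [u _ <-]; have [v [h [uv hv]]] := point_pushing_exists u.
  exists (isotopy_class R p1 p2 (h @` trace f0)), v, h, (trace f0); split => //.
  exact/path_homotopicP.
have pushU g b b' : pi1 R p2 g -> pushes_to p1 g a b -> pushes_to p1 g a b' -> b = b'.
  move=> [u _ <-] /pushP[f [hf fu] ->] /pushP[f' [hf' fu'] ->].
  by apply: mk => //; apply: (homotopic_trans fu); exact: homotopic_sym.
(* The default [set0] is taken only outside [pi1 R p2]. *)
pose push (g : set {path (I01 R) from p2 to p2}) : set (set Y) := xget set0 [set b | pushes_to p1 g a b].
have push_pushes g : pi1 R p2 g -> pushes_to p1 g a (push g).
  by move=> /pushE[b hb]; rewrite /push; case: xgetP => // /(_ b).
have fcat (u : {path (I01 R) from p2 to p2}) : real_path u 0 = f0 1 by rewrite real_path0 f01.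
exists push.
  move=> g hg b; split=> [hb|->]; last exact: push_pushes.
  by apply: (pushU g) => //; exact: push_pushes.
split.
- move=> g hg; have := push_pushes g hg; case: hg => u _ <- /pushP[f [hf _] ->].
  by exists (trace f) => //; apply/(is_arcP hY); exists f.
- move=> g g' /set_mem hg /set_mem hg' e.
  have := push_pushes g hg; rewrite e; have := push_pushes g' hg'.
  case: hg => u _ <-; case: hg' => u' _ <-.
  move=> /pushP[f' [hf' fu'] ->] /pushP[f [hf fu] /(isotopy_class_eq hY hf' hf) i].
  apply/homotopy_class_eq.
  (* Injectivity: [f0] is cancelled on the left by concatenating with its reverse. *)
  have cuu : homotopic (path_cat f0 (real_path u)) (path_cat f0 (real_path u')).
    apply: (homotopic_trans (homotopic_sym fu)); apply: homotopic_trans fu'.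
    by apply: isotopic_homotopic; exact: homotopic_sym.
  have h (v : {path (I01 R) from p2 to p2}) :=
    homotopic_cat_rev cf0 (@continuous_real_path R Y p2 p2 v) (esym (fcat v)).
  apply: (homotopic_trans (h u)); apply: homotopic_trans (homotopic_sym (h u')).
  apply: homotopic_cat => //; first by rewrite path_rev1 path_cat0.
  by apply: homotopic_refl; exact: continuous_path_rev.
- move=> _ [_ /(is_arcP hY)[k hk ->] <-]; have [ck _ k0 k1] := hk.
  have cr := continuous_path_rev cf0.
  have r1 : path_rev f0 1 = k 0 by rewrite path_rev1 f00 k0.
  (* Surjectivity: the loop that goes back along [f0] and out along [k] pushes [f0] to an arc
     homotopic to [k]. *)
  have [u hu] : exists u : {path (I01 R) from p2 to p2},
      forall t, 0 <= t <= 1 -> real_path u t = path_cat (path_rev f0) k t.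
    apply: real_path_exists; first exact: continuous_path_cat.
      by rewrite path_cat0 path_rev0.
    by rewrite path_cat1.
  have pu : pi1 R p2 (homotopy_class u) by exists u.
  exists (homotopy_class u) => //; apply: (pushU _ _ _ pu (push_pushes _ pu)).
  apply/pushP; exists k => //; split => //.
  have := homotopic_cat_rev cr ck r1; rewrite path_revK => h.
  apply: (homotopic_trans h); apply: homotopic_cat; first by rewrite path_cat0 path_rev0.
    exact: homotopic_refl.
  (* The constant homotopy, spelled out because [real_path u] is known to equal the concatenation
     only on [0, 1]. *)
  exists (fun _ t => path_cat (path_rev f0) k t); split => //.
  - by apply: (continuous_compose (continuous_path_cat cr ck r1)); exact: continuous_snd.
  - by move=> t /hu.
Qed.

End PointPushing.

(** * Hausdorff property and charts of the punctured surface *)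

Section PuncturedSurface.
Context {R : realType} {X : topologicalType}.
Variable P : set X.

Lemma continuous_punctured_val : continuous (\val : punctured P -> X).
Proof. exact: initial_continuous. Qed.

Lemma hausdorff_punctured : hausdorff_space X -> hausdorff_space (punctured P).
Proof.
move=> hX x y xy; apply: val_inj; apply: hX => A B nA nB.
have [z [Az Bz]] := xy (\val @^-1` A) (\val @^-1` B)
  (continuous_punctured_val nA) (continuous_punctured_val nB).
by exists (\val z).
Qed.

Lemma punctured_chart (c : chart R X) (x : punctured P) :
  hausdorff_space X -> finite_set P -> is_chart c -> cdom c (\val x) ->
  exists2 c' : chart R (punctured P), is_chart c' & cdom c' x.
Proof.
move=> hX fP hc cx; have [oc [W oW e] cK cc ci] := hc.
pose D : set (punctured P) := \val @^-1` cdom c.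
pose f (y : punctured P) := cfun c (\val y).
(* The default [x] is returned only where [cinv c z] is a puncture, hence never on the image of
   [D]. *)
pose g (z : R * R) : punctured P := insubd x (cinv c z).
have oD : open D by apply: open_comp => // y _; exact: continuous_punctured_val.
have gf y : D y -> g (f y) = y.
  by move=> Dy; apply: val_inj; rewrite /g /f cinvK // val_insubd (valP y).
exists (Chart D f g) => //; split => //=.
(* The punctures in the chart have finitely many images, a closed set in the plane, so removing them
   leaves an open set. *)
- exists (W `\` (cfun c @` (P `&` cdom c))).
    rewrite setDE; apply: openI => //; apply: closed_openC.
    apply: (accessible_finite_set_closed.1 (hausdorff_accessible _)).
      exact: norm_hausdorff.
    by apply: finite_image; exact: finite_setIl.
  apply/seteqP; split => [_ [y Dy <-]|z [[Wz nz] hz]].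
    have [Wy hy] : (W `&` half_plane R) (f y) by rewrite -e; exists (\val y).
    split => //; split => // -[u [Pu cu] fu].
    have uy : u = \val y by rewrite -(cinvK hc cu) fu /f cinvK.
    by have := set_valP y; rewrite /= -uy.
  have : (W `&` half_plane R) z by [].
  rewrite -e => -[u cu uz].
  have Pu : u \in ~` P by rewrite inE => Pu; apply: nz; exists u.
  by exists (exist _ u Pu).
- by move=> y /set_mem; exact: gf.
- rewrite continuous_open_subspace // => y /set_mem Dy N Nf.
  have := cfun_near hc Dy Nf; rewrite /= nbhs_simpl /= => n.
  have := continuous_punctured_val n; rewrite nbhs_simpl /=.
  by apply: filterS => z [].
- have sub : f @` D `<=` cfun c @` cdom c by move=> _ [y Dy <-]; exists (\val y).
  apply: (@continuous_comp_initial _ (subspace (f @` D)) _ _ g).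
  apply: (@subspace_eq_continuous _ (f @` D) _ (cinv c)); last exact: continuous_subspaceW ci.
  by move=> _ /set_mem [y Dy <-]; rewrite /= gf // /f cinvK.
Qed.

End PuncturedSurface.

Theorem theorem4 (R : realType) (X : topologicalType) (A : set (chart R X))
    (P : set X) (p1 p2 : punctured P) :
  compact_oriented_surface A ->
  finite_set P ->
  P `<=` interior_point R X ->
  boundary R (punctured P) !=set0 ->
  boundary R (punctured P) p1 ->
  interior_point R (punctured P) p2 ->
  forall a : set (set (punctured P)), arc_classes R p1 p2 a ->
  exists2 push : set {path (I01 R) from p2 to p2} -> set (set (punctured P)),
    (forall g, pi1 R p2 g -> forall b, pushes_to p1 g a b <-> b = push g) &
    set_bij (pi1 R p2) (arc_classes R p1 p2) push.
Proof.
move=> [hX _ [hA Acover _]] fP _ _ bp1 ip2.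
apply: point_pushing_bijection => //; first exact: hausdorff_punctured.
by move=> y; have [c Ac cy] := Acover (\val y); apply: punctured_chart fP (hA c Ac) cy.
Qed.
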